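(* Let $X$ be a locally compact metrizable space, $\phi:X\to X$ a homeomorphism, and $\mathcal A=C_0(X)\times_\phi\mathbb Z_+$ the semicrossed product. Let $A,B\in\mathcal A$ and write $f_m=E_m(A)\in C_0(X)$, $g_m=E_m(B)\in C_0(X)$ for all $m\in\mathbb Z_+$. The following statements are equivalent. (1) The multiplication operator $M_{A,B}:\mathcal A\to\mathcal A$, $M_{A,B}(T)=ATB$, is compact. (2) For all $m,n\in\mathbb Z_+$ the following hold: (a) for all $l\in\mathbb Z_+$ and all $x\in X_a$, $f_m(\phi^{n+l}(x))\,g_n(x)=0$; (b) for all $x\in X_i$, $\lim_{l\to\infty} f_m(\phi^{n+l}(x))\,g_n(x)=0$; (c) the sequence of functions $\{(f_m\circ\phi^{n+l})\,g_n\}_{l\in\mathbb Z_+}$ is pointwise equicontinuous on $X$, i.e. equicontinuous at every point of $X$.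
   Context: $\mathbb Z_+=\{0,1,2,\dots\}$. $X_i$ denotes the set of isolated points of $X$ and $X_a$ the set of accumulation points of $X$. Semicrossed product: $\mathbb Z_+$ acts on $C_0(X)$ (complex-valued continuous functions vanishing at infinity) by the isometric $*$-automorphisms $\alpha^n(f)=f\circ\phi^n$. The Banach space $\ell^1(\mathbb Z_+,C_0(X))$, whose elements are written as formal series $A=\sum_{n\in\mathbb Z_+}U^nf_n$ with norm $\sum_n\|f_n\|$, is a Banach algebra with the multiplication determined by $U^nf\,U^mg=U^{n+m}(\alpha^m(f)g)$. Let $C_0(X)$ act faithfully on a Hilbert space $\mathcal H_0$. A faithful contractive representation $\pi$ of $\ell^1(\mathbb Z_+,C_0(X))$ on $\mathcal H_0\otimes\ell^2(\mathbb Z_+)$ is defined by $\pi(U^nf)(\xi\otimes e_k)=\alpha^k(f)\xi\otimes e_{k+n}$. The semicrossed product $\mathcal A=C_0(X)\times_\phi\mathbb Z_+$ is the operator-norm closure of the image of $\pi$; one writes $U^nf$ for $\pi(U^nf)$. Fourier coefficients: for $A=\sum_nU^nf_n\in\ell^1(\mathbb Z_+,C_0(X))$ put $E_n(A)=f_n$. The maps $E_n$ are contractive for the operator norm and extend to contractions $E_n:\mathcal A\to C_0(X)$; $E_n(A)$ is the $n$th Fourier coefficient of $A\in\mathcal A$. *)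

(* Defs.v *)
From HB Require Import structures.
From mathcomp Require Import all_boot all_order all_algebra complex.
From mathcomp Require Import all_classical all_reals all_analysis.
From mathcomp Require Import ring lra.

Set Implicit Arguments.
Unset Strict Implicit.
Unset Printing Implicit Defensive.

Import Order.TTheory GRing.Theory Num.Theory.
Import numFieldNormedType.Exports.

Local Open Scope classical_set_scope.
Local Open Scope ring_scope.
Local Open Scope complex_scope.

HB.instance Definition _ (R : realType) := NormedModule.copy R[i] R[i]^o.

(* Norms of an [R[i]]-normed module take their values in [R[i]]; [rnorm] is the
   same norm seen as a real number. *)
Definition rnorm (R : realType) (V : normedModType R[i]) (v : V) : R :=
  complex.Re `|v|.

Lemma rnorm_norm (R : realType) (z : R[i]) : (rnorm z)%:C = `|z|.
Proof. by rewrite /rnorm RRe_real// normr_real. Qed.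

Lemma rnorm_real (R : realType) (r : R) : rnorm (r%:C : R[i]) = `|r|.
Proof. by rewrite /rnorm normc_def/= expr0n/= addr0 sqrtr_sqr. Qed.

Section rnorm_theory.
Context {R : realType} {V : normedModType R[i]}.
Implicit Types (v w : V) (z : R[i]) (r : R).

Lemma rnormE v : (rnorm v)%:C = `|v|.
Proof. by rewrite /rnorm RRe_real// normr_real. Qed.

Lemma rnorm_ge0 v : 0 <= rnorm v.
Proof. by rewrite -ler0c rnormE. Qed.

Lemma rnormD v w : rnorm (v + w) <= rnorm v + rnorm w.
Proof. by rewrite -lecR rmorphD/= !rnormE ler_normD. Qed.

Lemma rnorm0 : rnorm (0 : V) = 0.
Proof. by apply: complexI; rewrite rnormE normr0. Qed.

Lemma rnorm0_eq0 v : rnorm v = 0 -> v = 0.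
Proof. by move=> v0; apply/normr0_eq0; rewrite -rnormE v0. Qed.

Lemma rnormN v : rnorm (- v) = rnorm v.
Proof. by rewrite /rnorm normrN. Qed.

Lemma rnormZ z v : rnorm (z *: v) = rnorm z * rnorm v.
Proof.
by apply: complexI; rewrite rmorphM/= rnormE normrZ -rnormE -rnorm_norm.
Qed.

Lemma rnorm_le v r : (rnorm v <= r) = (`|v| <= r%:C).
Proof. by rewrite -rnormE lecR. Qed.

End rnorm_theory.

(* A normed module from a real-valued norm; subhomogeneity is enough. *)
HB.factory Record Lmodule_isRealNormed (R : realType) M
    & GRing.Lmodule R[i] M := {
  rnm : M -> R;
  rnmD : forall x y, rnm (x + y) <= rnm x + rnm y;
  rnmZ_le : forall (z : R[i]) x, rnm (z *: x) <= rnorm z * rnm x;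
  rnm0_eq0 : forall x, rnm x = 0 -> x = 0
}.

HB.builders Context R M & Lmodule_isRealNormed R M.

Let rnm0 : rnm 0 = 0.
Proof.
apply/eqP; rewrite eq_le; apply/andP; split.
  by have := rnmZ_le 0 0; rewrite scale0r rnorm0 mul0r.
by have := rnmD 0 0; rewrite addr0 lerDl.
Qed.

Let rnm_ge0 x : 0 <= rnm x.
Proof.
have := le_trans (rnmD x (-1 *: x)) (lerD (lexx _) (rnmZ_le (-1) x)).
rewrite scaleN1r subrr rnm0 rnormN.
have -> : rnorm (1 : R[i]) = 1 by apply: complexI; rewrite rnorm_norm normr1.
by rewrite mul1r -mulr2n pmulrn_lge0.
Qed.

Let rnmZ (z : R[i]) x : rnm (z *: x) = rnorm z * rnm x.
Proof.
have [->|z0] := eqVneq z 0; first by rewrite scale0r rnorm0 mul0r rnm0.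
apply/eqP; rewrite eq_le rnmZ_le/= -ler_pdivlMl; last first.
  by rewrite lt_def rnorm_ge0 andbT; apply: contra z0 => /eqP/rnorm0_eq0 ->.
have := rnmZ_le z^-1 (z *: x); rewrite scalerA mulVf// scale1r => /le_trans.
apply; rewrite ler_wpM2r ?rnm_ge0//.
by rewrite -lecR fmorphV/= !rnorm_norm normfV.
Qed.

Let nm (x : M) : R[i] := (rnm x)%:C.

Let nmD x y : nm (x + y) <= nm x + nm y.
Proof. by rewrite /nm -rmorphD/= lecR; exact: rnmD. Qed.

Let nmZ (z : R[i]) x : nm (z *: x) = `|z| * nm x.
Proof. by rewrite /nm rnmZ rmorphM/= rnorm_norm. Qed.

Let nm0_eq0 x : nm x = 0 -> x = 0.
Proof. by move=> /complexI/rnm0_eq0. Qed.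

HB.instance Definition _ := Lmodule_isNormed.Build R[i] M nmD nmZ nm0_eq0.

HB.end.

Section l2seq.
Context {R : realType} {V : normedModType R[i]}.
Implicit Types (v w : nat -> V).

Definition is_l2 : {pred nat -> V} :=
  fun v => `[< cvgn (series (fun k => rnorm (v k) ^+ 2)) >].

Definition l2norm v : R := Num.sqrt (limn (series (fun k => rnorm (v k) ^+ 2))).

Definition l2part n v : R := Num.sqrt (\sum_(k < n) rnorm (v k) ^+ 2).

Lemma l2part_ge0 n v : 0 <= l2part n v.
Proof. exact: sqrtr_ge0. Qed.

Let sum_ge0 n v : 0 <= \sum_(k < n) rnorm (v k) ^+ 2.
Proof. by apply: sumr_ge0 => i _; rewrite sqr_ge0. Qed.

Let l2partS n v : l2part n.+1 v = Num.sqrt (l2part n v ^+ 2 + rnorm (v n) ^+ 2).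
Proof. by rewrite /l2part big_ord_recr/= sqr_sqrtr ?sum_ge0. Qed.

Let serE v n :
  series (fun k => rnorm (v k) ^+ 2) n = \sum_(k < n) rnorm (v k) ^+ 2.
Proof. by rewrite /series/= big_mkord. Qed.

Let ser_nd v : nondecreasing_seq (series (fun k => rnorm (v k) ^+ 2)).
Proof.
apply/nondecreasing_seqP => n; rewrite !serE big_ord_recr/= lerDl.
exact: sqr_ge0.
Qed.

Lemma l2P v : reflect
  (exists M : R, forall n, l2part n v <= M)
  (v \in is_l2).
Proof.
apply: (iffP idP) => [/asboolP cv|[M vM]]; last apply/asboolP.
  exists (l2norm v) => n; rewrite /l2part ler_wsqrtr// -serE.
  exact: nondecreasing_cvgn_le.
apply: nondecreasing_is_cvgn => //; exists (M ^+ 2) => _ [n _ <-].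
have M0 : 0 <= M by exact: le_trans (l2part_ge0 _ _) (vM 0%N).
rewrite serE -[leLHS]sqr_sqrtr ?sum_ge0// ler_sqr ?nnegrE ?sqrtr_ge0//.
exact: vM.
Qed.

Lemma l2norm_ge v n : v \in is_l2 ->
  l2part n v <= l2norm v.
Proof.
move=> /asboolP cv; rewrite /l2part ler_wsqrtr// -serE.
exact: nondecreasing_cvgn_le.
Qed.

Lemma l2norm_le v (M : R) : v \in is_l2 ->
  (forall n, l2part n v <= M) -> l2norm v <= M.
Proof.
move=> /asboolP cv vM.
have M0 : 0 <= M by exact: le_trans (l2part_ge0 _ _) (vM 0%N).
rewrite -[leRHS]ger0_norm// -sqrtr_sqr ler_wsqrtr//.
apply: limr_le => //; near=> n.
by rewrite serE -[leLHS]sqr_sqrtr ?sum_ge0// ler_sqr ?nnegrE ?l2part_ge0//; exact: vM.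
Unshelve. all: by end_near. Qed.

Lemma l2partD n v w : l2part n (v + w) <= l2part n v + l2part n w.
Proof.
elim: n => [|n ih]; first by rewrite /l2part !big_ord0 sqrtr0 addr0.
have /= := @le_normcD R (l2part n v +i* rnorm (v n)) (l2part n w +i* rnorm (w n)).
rewrite -!l2partS; apply: le_trans; rewrite l2partS ler_wsqrtr//.
by rewrite lerD// ler_sqr ?nnegrE ?addr_ge0 ?sqrtr_ge0 ?rnorm_ge0// rnormD.
Qed.

Lemma l2partZ n (z : R[i]) v : l2part n (z *: v) = rnorm z * l2part n v.
Proof.
rewrite /l2part -[rnorm z]ger0_norm ?rnorm_ge0// -sqrtr_sqr -sqrtrM ?sqr_ge0//.
by rewrite mulr_sumr; congr Num.sqrt; apply: eq_bigr => k _; rewrite rnormZ exprMn.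
Qed.

Lemma is_l2_submod : submod_closed is_l2.
Proof.
split=> [|z v w /l2P[M vM] /l2P[N wN]].
  apply/l2P; exists 0 => n; rewrite /l2part big1 ?sqrtr0// => k _.
  by rewrite rnorm0 expr0n.
apply/l2P; exists (rnorm z * M + N) => n; apply: le_trans (l2partD _ _ _) _.
by apply: lerD; [rewrite l2partZ ler_wpM2l ?rnorm_ge0 ?vM|exact: wN].
Qed.

HB.instance Definition _ :=
  GRing.isSubmodClosed.Build R[i] (nat -> V) is_l2 is_l2_submod.

End l2seq.

(* The Hilbert space tensor product [V (x) l^2(N)], as the space of
   square-summable [V]-valued sequences: [xi (x) e_k] is the sequence whose only
   nonzero term is [xi], at index [k]. *)
Record l2 (R : realType) (V : normedModType R[i]) :=
  L2 { l2_fun :> nat -> V; l2_funP : l2_fun \in is_l2 }.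
Arguments L2 {R V}.

Section l2_module.
Context {R : realType} {V : normedModType R[i]}.

HB.instance Definition _ := [isSub for @l2_fun R V].
HB.instance Definition _ := [Choice of l2 V by <:].
HB.instance Definition _ := [SubChoice_isSubLmodule of l2 V by <:].

Implicit Types v w : l2 V.

Let nrmD v w : l2norm (v + w : l2 V) <= l2norm v + l2norm w.
Proof.
apply: l2norm_le => [|n]; first exact: valP.
rewrite (le_trans (l2partD n v w))// lerD// l2norm_ge//; exact: valP.
Qed.

Let nrmZ_le (z : R[i]) v : l2norm (z *: v : l2 V) <= rnorm z * l2norm v.
Proof.
apply: l2norm_le => [|n]; first exact: valP.
rewrite (le_trans _ (ler_wpM2l (rnorm_ge0 z) (l2norm_ge n (valP v))))//.
by rewrite -l2partZ.
Qed.

Let nrm0_eq0 v : l2norm v = 0 -> v = 0.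
Proof.
move=> v0; apply/val_inj/funext => k /=; apply: rnorm0_eq0.
have := l2norm_ge k.+1 (valP v); rewrite v0 => vk.
have : Num.sqrt (rnorm (v k) ^+ 2) <= 0.
  apply: le_trans vk; rewrite ler_wsqrtr// big_ord_recr/= lerDr.
  by apply: sumr_ge0 => i _; exact: sqr_ge0.
rewrite sqrtr_sqr normr_le0 => /eqP //.
Qed.

HB.instance Definition _ :=
  Lmodule_isRealNormed.Build R (l2 V) nrmD nrmZ_le nrm0_eq0.

Lemma rnorm_l2 v : rnorm v = l2norm v.
Proof. by rewrite /rnorm. Qed.

End l2_module.

Section bounded_operators.
Context {R : realType} {V : normedModType R[i]}.
Implicit Types T : V -> V.

Definition is_bop : {pred V -> V} := fun T => `[< linear T /\ continuous T >].

Definition opnorm T : R := sup [set rnorm (T v) | v in [set v | rnorm v <= 1]].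

Lemma bopP T : reflect
  (linear T /\ exists M : R, forall v, rnorm (T v) <= M * rnorm v)
  (T \in is_bop).
Proof.
apply: (iffP idP) => [/asboolP[lT cT]|[lT [M TM]]]; last apply/asboolP.
  split=> //; pose lT' := GRing.isLinear.Build _ _ _ _ T lT.
  pose T' : {linear V -> V} := HB.pack T lT'.
  have /linear_bounded_continuous/linear_boundedP : continuous T' by [].
  move=> /pinfty_ex_gt0[r r0 Tr]; exists (complex.Re r) => v.
  by rewrite -lecR rmorphM/= !rnormE RRe_real ?gtr0_real ?Tr.
split=> //; pose lT' := GRing.isLinear.Build _ _ _ _ T lT.
pose T' : {linear V -> V} := HB.pack T lT'.
suff: continuous T' by [].
apply/linear_bounded_continuous/bounded_funP => r; exists (`|M|%:C * r) => v vr.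
rewrite -[leLHS]rnormE (@le_trans _ _ (`|M| * rnorm v)%:C)//.
  rewrite lecR (le_trans (TM v))// ler_wpM2r ?rnorm_ge0//; exact: ler_norm.
by rewrite rmorphM/= rnormE ler_wpM2l// ler0c.
Qed.

Lemma opnorm_ge T v : T \in is_bop -> rnorm (T v) <= opnorm T * rnorm v.
Proof.
move=> /bopP[lT [M TM]].
pose lT' := GRing.isLinear.Build _ _ _ _ T lT.
pose T' : {linear V -> V} := HB.pack T lT'.
have TE : T = T' by [].
have [->|v0] := eqVneq v 0; first by rewrite TE linear0 rnorm0 mulr0.
have nv0 : 0 < rnorm v.
  by rewrite lt_def rnorm_ge0 andbT; apply: contra v0 => /eqP/rnorm0_eq0 ->.
have nV : rnorm ((rnorm v)^-1%:C : R[i]) = (rnorm v)^-1.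
  by rewrite rnorm_real ger0_norm// invr_ge0 ltW.
rewrite -ler_pdivrMr// mulrC -nV -rnormZ.
have -> : (rnorm v)^-1%:C *: T v = T ((rnorm v)^-1%:C *: v) by rewrite TE linearZ.
apply: ub_le_sup.
  exists `|M| => _ [w /= w1 <-]; rewrite (le_trans (TM w))//.
  rewrite (le_trans (ler_wpM2r (rnorm_ge0 w) (ler_norm M)))//.
  by rewrite -[leRHS]mulr1 ler_wpM2l.
by exists ((rnorm v)^-1%:C *: v) => //=; rewrite rnormZ nV mulVf ?gt_eqF.
Qed.

Lemma opnorm_le T (M : R) : 0 <= M ->
  (forall v, rnorm (T v) <= M * rnorm v) -> opnorm T <= M.
Proof.
move=> M0 TM; apply: ge_sup; first by exists (rnorm (T 0)), 0; rewrite //= rnorm0.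
move=> _ [w /= w1 <-]; rewrite (le_trans (TM w))//.
by rewrite -[leRHS]mulr1 ler_wpM2l.
Qed.

Lemma opnorm_ge0 T : 0 <= opnorm T.
Proof.
rewrite /opnorm; set A := (X in sup X).
have [[A0 uA]|nA] := pselect (has_sup A); last by rewrite sup_out.
apply: le_trans (rnorm_ge0 (T 0)) _; apply: ub_le_sup => //.
by exists 0; rewrite //= rnorm0.
Qed.

Lemma is_bop_submod : submod_closed is_bop.
Proof.
split=> [|z S T /bopP[lS [M SM]] /bopP[lT [N TN]]].
  apply/bopP; split; first by move=> a u v /=; rewrite scaler0 addr0.
  by exists 0 => v; rewrite mul0r rnorm0.
apply/bopP; split.
  move=> a u v; rewrite -[LHS]/(z *: S (a *: u + v) + T (a *: u + v)) lS lT.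
  rewrite -[RHS]/(a *: (z *: S u + T u) + (z *: S v + T v)).
  by rewrite !scalerDr !scalerA [z * a]mulrC addrACA.
exists (rnorm z * M + N) => v; rewrite mulrDl (le_trans (rnormD _ _))// lerD//.
by rewrite rnormZ -mulrA ler_wpM2l ?rnorm_ge0.
Qed.

HB.instance Definition _ :=
  GRing.isSubmodClosed.Build R[i] (V -> V) is_bop is_bop_submod.

End bounded_operators.

Record bop (R : realType) (V : normedModType R[i]) :=
  Bop { bop_fun :> V -> V; bop_funP : bop_fun \in is_bop }.
Arguments Bop {R V}.

Section bop_module.
Context {R : realType} {V : normedModType R[i]}.

HB.instance Definition _ := [isSub for @bop_fun R V].
HB.instance Definition _ := [Choice of bop V by <:].
HB.instance Definition _ := [SubChoice_isSubLmodule of bop V by <:].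

Implicit Types S T : bop V.

Let nrmD S T : opnorm (S + T : bop V) <= opnorm S + opnorm T.
Proof.
apply: opnorm_le; first by rewrite addr_ge0 ?opnorm_ge0.
move=> v; rewrite mulrDl (le_trans (rnormD _ _))// lerD// opnorm_ge//; exact: valP.
Qed.

Let nrmZ_le (z : R[i]) T : opnorm (z *: T : bop V) <= rnorm z * opnorm T.
Proof.
apply: opnorm_le; first by rewrite mulr_ge0 ?rnorm_ge0 ?opnorm_ge0.
move=> v; rewrite rnormZ -mulrA ler_wpM2l ?rnorm_ge0// opnorm_ge//; exact: valP.
Qed.

Let nrm0_eq0 T : opnorm T = 0 -> T = 0.
Proof.
move=> T0; apply/val_inj/funext => v /=; apply: rnorm0_eq0; apply/eqP.
rewrite eq_le rnorm_ge0 andbT (le_trans (opnorm_ge v (valP T)))//.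
by rewrite T0 mul0r.
Qed.

HB.instance Definition _ :=
  Lmodule_isRealNormed.Build R (bop V) nrmD nrmZ_le nrm0_eq0.

Lemma rnorm_bop T : rnorm T = opnorm T.
Proof. by []. Qed.

Lemma bop_le T v : rnorm (T v) <= rnorm T * rnorm v.
Proof. exact: opnorm_ge (valP T). Qed.

Lemma bop_linear T : linear T.
Proof. by have /bopP[] := valP T. Qed.

HB.instance Definition _ T :=
  GRing.isLinear.Build R[i] V V *:%R (bop_fun T) (bop_linear T).

Lemma bop_comp_subproof S T : (S \o T)%FUN \in is_bop.
Proof.
apply/bopP; split; first by move=> a u v; rewrite /= !bop_linear.
exists (rnorm S * rnorm T) => v /=; rewrite (le_trans (bop_le _ _))// -mulrA.
by rewrite ler_wpM2l ?rnorm_ge0 ?bop_le.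
Qed.

Definition bop_comp S T : bop V := Bop _ (bop_comp_subproof S T).

End bop_module.

Lemma rnorm_dist (R : realType) (V : normedModType R[i]) (v w : V) :
  `|rnorm v - rnorm w| <= rnorm (v - w).
Proof.
rewrite ler_norml; apply/andP; split.
  rewrite lerNl opprB lerBlDr -[rnorm (v - w)]rnormN opprB.
  by rewrite -[in leLHS](subrK v w) rnormD.
by rewrite lerBlDr -[in leLHS](subrK w v) rnormD.
Qed.

Lemma rnorm_continuous (R : realType) (V : normedModType R[i]) :
  continuous (@rnorm R V).
Proof.
move=> v; apply/cvgrPdist_lt => e e0.
have e0' : 0 < e%:C by rewrite ltcR.
near=> w; apply: le_lt_trans (rnorm_dist _ _) _.
rewrite -ltcR rnormE; near: w; exact: cvgr_dist_lt.
Unshelve. all: by end_near. Qed.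

Lemma real_complex_continuous (R : realType) :
  continuous (fun r : R => r%:C : R[i]).
Proof.
move=> r; apply/cvgrPdist_lt => e e0.
have eE : (complex.Re e)%:C = e by rewrite RRe_real// gtr0_real.
have e0' : 0 < complex.Re e by rewrite -ltcR eE.
near=> s; rewrite -rmorphB/= -rnorm_norm rnorm_real -eE ltcR.
near: s; exact: cvgr_dist_lt.
Unshelve. all: by end_near. Qed.

Section C0.
Context {R : realType} {X : topologicalType}.
Implicit Types f g : X -> R[i].

Definition is_C0 : {pred X -> R[i]} := fun f => `[< continuous f /\
  forall e : R, 0 < e -> exists2 K : set X, compact K &
    forall x, ~ K x -> rnorm (f x) < e >].

Definition supnorm f : R := sup (range (fun x => rnorm (f x))).

Lemma C0_bounded f : f \in is_C0 -> exists M : R, forall x, rnorm (f x) <= M.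
Proof.
move=> /asboolP[cf /(_ 1 ltr01)[K cK Kf]].
have : compact ((fun x => rnorm (f x)) @` K).
  apply: continuous_compact => //; apply: continuous_subspaceT => x.
  by apply: continuous_comp; [exact: cf|exact: rnorm_continuous].
move=> /compact_bounded[M [_ MK]].
exists (Num.max 1 (M + 1)) => x; rewrite le_max.
have [Kx|nKx] := pselect (K x); last by rewrite ltW// Kf.
have MM : M < M + 1 by rewrite ltrDl.
have /(le_trans (ler_norm _)) -> := MK _ MM (rnorm (f x)) (imageP _ Kx).
by rewrite orbT.
Qed.

Lemma supnorm_ge f x : f \in is_C0 -> rnorm (f x) <= supnorm f.
Proof.
move=> /C0_bounded[M fM]; apply: ub_le_sup; last by exists x.
by exists M => _ [y _ <-].
Qed.

Lemma supnorm_ge0 f : 0 <= supnorm f.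
Proof.
rewrite /supnorm; set A := (X in sup X).
have [[[_ [x _ _]] uA]|nA] := pselect (has_sup A); last by rewrite sup_out.
by apply: le_trans (rnorm_ge0 (f x)) _; apply: ub_le_sup => //; exists x.
Qed.

Lemma supnorm_le f (M : R) : 0 <= M ->
  (forall x, rnorm (f x) <= M) -> supnorm f <= M.
Proof.
move=> M0 fM; rewrite /supnorm; set A := (X in sup X).
have [[A0 uA]|nA] := pselect (has_sup A); last by rewrite sup_out.
by apply: ge_sup => // _ [x _ <-].
Qed.

Lemma C0_dominated f g (M : R) : g \in is_C0 -> continuous f ->
  (forall x, rnorm (f x) <= M * rnorm (g x)) -> f \in is_C0.
Proof.
move=> /asboolP[cg g0] cf fg; apply/asboolP; split => // e e0.
have M0 : 0 < `|M| + 1 by rewrite ltr_wpDl.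
have [|K cK Kg] := g0 (e / (`|M| + 1)); first by rewrite divr_gt0.
exists K => // x /Kg gx; apply: le_lt_trans (fg x) _.
apply: (@le_lt_trans _ _ ((`|M| + 1) * rnorm (g x))).
  by rewrite ler_wpM2r ?rnorm_ge0// (le_trans (ler_norm M))// lerDl.
by rewrite mulrC -ltr_pdivlMr.
Qed.

Lemma is_C0_submod : submod_closed is_C0.
Proof.
split=> [|z f g Cf Cg].
  apply/asboolP; split; first exact: cst_continuous.
  by move=> e e0; exists set0; [exact: compact0|move=> x _; rewrite rnorm0].
have Czf : (fun x => z *: f x) \in is_C0.
  apply: (C0_dominated (M := rnorm z) Cf) => [x|x]; last by rewrite rnormZ.
  by move/asboolP: Cf => [cf _]; apply: cvgZr; exact: cf.
move: Czf Cg => /asboolP[czf zf0] /asboolP[cg g0].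
apply/asboolP; split=> [x|e e0]; first by apply: cvgD; [exact: czf|exact: cg].
have e20 : 0 < e / 2 by rewrite divr_gt0.
have [K cK Kf] := zf0 _ e20; have [L cL Lg] := g0 _ e20.
exists (K `|` L); first exact: compactU.
move=> x /not_orP[nK nL]; rewrite (splitr e).
by apply: le_lt_trans (rnormD _ _) _; rewrite ltrD ?Kf ?Lg.
Qed.

HB.instance Definition _ :=
  GRing.isSubmodClosed.Build R[i] (X -> R[i]) is_C0 is_C0_submod.

End C0.

Record C0 (R : realType) (X : topologicalType) :=
  MkC0 { C0_fun :> X -> R[i]; C0_funP : C0_fun \in is_C0 }.
Arguments MkC0 {R X}.

Section C0_module.
Context {R : realType} {X : topologicalType}.

HB.instance Definition _ := [isSub for @C0_fun R X].
HB.instance Definition _ := [Choice of C0 R X by <:].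
HB.instance Definition _ := [SubChoice_isSubLmodule of C0 R X by <:].

Implicit Types f g : C0 R X.

Let nrmD f g : supnorm (f + g : C0 R X) <= supnorm f + supnorm g.
Proof.
apply: supnorm_le; first by rewrite addr_ge0 ?supnorm_ge0.
by move=> x; rewrite (le_trans (rnormD _ _))// lerD// supnorm_ge//; exact: valP.
Qed.

Let nrmZ_le (z : R[i]) f : supnorm (z *: f : C0 R X) <= rnorm z * supnorm f.
Proof.
apply: supnorm_le; first by rewrite mulr_ge0 ?rnorm_ge0 ?supnorm_ge0.
move=> x; rewrite rnormZ ler_wpM2l ?rnorm_ge0// supnorm_ge//; exact: valP.
Qed.

Let nrm0_eq0 f : supnorm f = 0 -> f = 0.
Proof.
move=> f0; apply/val_inj/funext => x /=; apply: rnorm0_eq0; apply/eqP.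
by rewrite eq_le rnorm_ge0 andbT -f0; apply: supnorm_ge; exact: valP.
Qed.

HB.instance Definition _ :=
  Lmodule_isRealNormed.Build R (C0 R X) nrmD nrmZ_le nrm0_eq0.

Lemma rnorm_C0 f : rnorm f = supnorm f.
Proof. by []. Qed.

Lemma C0_le f x : rnorm (f x) <= rnorm f.
Proof. exact: supnorm_ge (valP f). Qed.

Lemma C0_continuous f : continuous f.
Proof. by have /asboolP[] := valP f. Qed.

Lemma rnormM (z w : R[i]) : rnorm (z * w) = rnorm z * rnorm w.
Proof. exact: (@rnormZ _ R[i]). Qed.

Lemma C0_mul_subproof f g : (fun x => f x * g x) \in is_C0.
Proof.
apply: (C0_dominated (M := rnorm f) (valP g)) => x.
  by apply: cvgM; exact: C0_continuous.
by rewrite rnormM ler_wpM2r ?rnorm_ge0 ?C0_le.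
Qed.

Definition C0_mul f g : C0 R X := MkC0 _ (C0_mul_subproof f g).

Lemma rnorm_conj (z : R[i]) : rnorm z^* = rnorm z.
Proof. by case: z => a b; rewrite /rnorm !normc_def/= sqrrN. Qed.

Lemma C0_conj_subproof f : (fun x => (f x)^*) \in is_C0.
Proof.
apply: (C0_dominated (M := 1) (valP f)) => x; last by rewrite rnorm_conj mul1r.
apply/cvgrPdist_lt => e e0; near=> y.
rewrite -rmorphB/= -rnorm_norm rnorm_conj rnorm_norm; near: y.
by apply: cvgr_dist_lt => //; exact: C0_continuous.
Unshelve. all: by end_near. Qed.

Definition C0_conj f : C0 R X := MkC0 _ (C0_conj_subproof f).

End C0_module.

Record homeo (X : topologicalType) := Homeo {
  homeo_fun :> X -> X;
  homeo_inv : X -> X;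
  homeo_funK : cancel homeo_fun homeo_inv;
  homeo_invK : cancel homeo_inv homeo_fun;
  homeo_fun_continuous : continuous homeo_fun;
  homeo_inv_continuous : continuous homeo_inv }.

Section alpha.
Context {R : realType} {X : topologicalType} (phi : homeo X).

Lemma alpha_subproof (f : C0 R X) : (f \o phi)%FUN \in is_C0.
Proof.
have /asboolP[cf f0] := valP f; apply/asboolP; split=> [x|e /f0[K cK Kf]].
  by apply: continuous_comp; [exact: homeo_fun_continuous|exact: cf].
exists (homeo_inv phi @` K).
  apply: continuous_compact => //; apply: continuous_subspaceT.
  exact: homeo_inv_continuous.
move=> x nKx; apply: Kf => Kx; apply: nKx; exists (phi x) => //.
exact: homeo_funK.
Qed.

Definition alpha (f : C0 R X) : C0 R X := MkC0 _ (alpha_subproof f).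

Lemma iter_alphaE n (f : C0 R X) x : iter n alpha f x = f (iter n phi x).
Proof. by elim: n f x => // n ih f x; rewrite iterSr ih. Qed.

Lemma alpha_le (f : C0 R X) : rnorm (alpha f) <= rnorm f.
Proof. by apply: supnorm_le; [exact: rnorm_ge0|move=> x; exact: (C0_le f (phi x))]. Qed.

Lemma iter_alpha_le n (f : C0 R X) : rnorm (iter n alpha f) <= rnorm f.
Proof. by elim: n => // n; apply: le_trans; exact: alpha_le. Qed.

End alpha.

(* The inner product of a [{dot _ for _}] is linear in its first argument. *)
Record hilbert (R : realType) := Hilbert {
  hilbert_car :> completeNormedModType R[i];
  hdot : {dot hilbert_car for Num.conj};
  hdotE : forall v, hdot v v = `|v| ^+ 2 }.
Arguments hdot {R h}.

(* [rep_conj]: the image of the complex conjugate of [f] is the adjoint of the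
   image of [f]. *)
Record faithful_rep (R : realType) (X : topologicalType) (H : hilbert R) :=
  FaithfulRep {
    rep :> C0 R X -> bop H;
    rep_linear : linear rep;
    rep_mul : forall f g, rep (C0_mul f g) = bop_comp (rep f) (rep g);
    rep_conj : forall f v w, hdot (rep f v) w = hdot v (rep (C0_conj f) w);
    rep_inj : injective rep }.
Arguments rep_conj {R X H}.

Section rep_contractive.
Context {R : realType} {X : topologicalType} {H : hilbert R}.
Variable rho : faithful_rep X H.

HB.instance Definition _ :=
  GRing.isLinear.Build R[i] (C0 R X) (bop H) *:%R (rep rho) (rep_linear rho).

(* Contractivity of [rho], avoiding the C*-algebra theory: if [|f| <= 1] and
   [g := 1 - sqrt (1 - |f|^2)], then [|f|^2 = 2 g - g^2], so that
   [|rho f v|^2 = |v|^2 - |v - rho g v|^2]. *)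
Let gfun (f : C0 R X) (x : X) : R := 1 - Num.sqrt (1 - rnorm (f x) ^+ 2).

Let gfunP (f : C0 R X) : rnorm f <= 1 -> (fun x => (gfun f x)%:C) \in is_C0.
Proof.
move=> f1; apply: (C0_dominated (M := 1) (valP f)) => x.
  apply: (@continuous_comp _ _ _ (gfun f)); last exact: real_complex_continuous.
  apply: cvgB; first exact: cvg_cst.
  apply: (@continuous_comp _ _ _ (fun x => 1 - rnorm (f x) ^+ 2)); last first.
    exact: sqrt_continuous.
  apply: cvgB; first exact: cvg_cst.
  have cf : {for x, continuous (fun y => rnorm (f y))}.
    by apply: continuous_comp; [exact: C0_continuous|exact: rnorm_continuous].
  exact: cvgM.
have fx1 : rnorm (f x) <= 1 by exact: le_trans (C0_le f x) f1.
have fx0 := rnorm_ge0 (f x).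
have u0 : 0 <= 1 - rnorm (f x) ^+ 2 by rewrite subr_ge0 expr_le1.
have s1 : Num.sqrt (1 - rnorm (f x) ^+ 2) <= 1.
  by rewrite -[leRHS]sqrtr1 ler_wsqrtr// gerBl sqr_ge0.
rewrite mul1r rnorm_real ger0_norm ?subr_ge0// lerBlDr -lerBlDl.
rewrite -(@ler_sqr R) ?nnegrE ?subr_ge0 ?sqrtr_ge0// sqr_sqrtr//.
by have := ler_piMl fx0 fx1; nra.
Qed.

Lemma rep_contract (f : C0 R X) v : rnorm f <= 1 -> rnorm (rho f v) <= rnorm v.
Proof.
move=> f1; pose g : C0 R X := MkC0 _ (gfunP f1).
have gc : C0_conj g = g.
  by apply/val_inj/funext => x /=; rewrite oppr0.
have gg : C0_mul (C0_conj f) f = g + g - C0_mul g g.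
  apply/val_inj/funext => x /=.
  have fx1 : rnorm (f x) <= 1 by exact: le_trans (C0_le f x) f1.
  have u0 : 0 <= 1 - rnorm (f x) ^+ 2 by rewrite subr_ge0 expr_le1 ?rnorm_ge0.
  have -> : (f x)^* * f x = (rnorm (f x) ^+ 2)%:C.
    by rewrite rmorphXn/= rnorm_norm mulrC sqr_normc.
  rewrite -[RHS]/((gfun f x)%:C + (gfun f x)%:C - (gfun f x)%:C * (gfun f x)%:C).
  rewrite -rmorphD -rmorphM -rmorphB/=; congr (_%:C).
  rewrite /gfun; set s := Num.sqrt _.
  have -> : rnorm (f x) ^+ 2 = 1 - s ^+ 2 by rewrite sqr_sqrtr// subKr.
  by ring.
have sym a b : hdot (rho g a) b = hdot a (rho g b) by rewrite rep_conj gc.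
suff : `|rho f v| ^+ 2 <= `|v| ^+ 2.
  by rewrite -!rnormE -!rmorphXn/= lecR ler_sqr ?nnegrE ?rnorm_ge0.
rewrite -!hdotE rep_conj.
have -> : rho (C0_conj f) (rho f v) = rho g v + rho g v - rho g (rho g v).
  have -> : rho (C0_conj f) (rho f v) = rho (C0_mul (C0_conj f) f) v.
    by rewrite rep_mul.
  by rewrite gg linearB linearD/= rep_mul.
rewrite -subr_ge0.
have -> : hdot v v - hdot v (rho g v + rho g v - rho g (rho g v)) =
    hdot (v - rho g v) (v - rho g v).
  rewrite linearBr linearDr !linearBl/= !linearBr/= !sym.
  by ring.
exact: dnorm_ge0.
Qed.

Lemma rep_le (f : C0 R X) v : rnorm (rho f v) <= rnorm f * rnorm v.
Proof.
have [->|f0] := eqVneq f 0.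
  by rewrite linear0 !rnorm0 mul0r.
have nf0 : 0 < rnorm f.
  by rewrite lt_def rnorm_ge0 andbT; apply: contra f0 => /eqP/rnorm0_eq0 ->.
have nV : rnorm ((rnorm f)^-1%:C : R[i]) = (rnorm f)^-1.
  by rewrite rnorm_real ger0_norm// invr_ge0 ltW.
have := @rep_contract ((rnorm f)^-1%:C *: f) v.
rewrite rnormZ nV mulVf ?gt_eqF// => /(_ (lexx _)).
rewrite linearZ/= -[X in rnorm X]/((rnorm f)^-1%:C *: rho f v) rnormZ nV.
by rewrite ler_pdivrMl.
Qed.

End rep_contractive.

Section semicrossed_product.
Context {R : realType} {X : topologicalType} {H : hilbert R}.
Variables (phi : homeo X) (rho : faithful_rep X H).

(* The operator [U^n f], which sends [xi (x) e_k] to [alpha^k(f) xi (x) e_(k + n)]. *)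
Definition Uf_fun n (f : C0 R X) (xi : l2 H) (j : nat) : H :=
  if (n <= j)%N then rho (iter (j - n) (alpha phi) f) (xi (j - n)%N) else 0.

Let Uf_part n f xi N : l2part N (Uf_fun n f xi) <= rnorm f * rnorm xi.
Proof.
apply: (@le_trans _ _ (rnorm f * l2part N xi)); last first.
  by rewrite ler_wpM2l ?rnorm_ge0// l2norm_ge//; exact: valP.
rewrite -[rnorm f]ger0_norm ?rnorm_ge0// -sqrtr_sqr -sqrtrM ?sqr_ge0//.
rewrite ler_wsqrtr// mulr_sumr.
rewrite -(big_mkord xpredT (fun j => rnorm (Uf_fun n f xi j) ^+ 2)).
rewrite -(big_mkord xpredT (fun k => rnorm f ^+ 2 * rnorm (xi k) ^+ 2)).
have t0 (F : nat -> R) m p : (forall k, 0 <= F k) -> 0 <= \sum_(m <= k < p) F k.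
  by move=> F0; apply: sumr_ge0.
have F0 k : 0 <= rnorm f ^+ 2 * rnorm (xi k) ^+ 2 by rewrite mulr_ge0 ?sqr_ge0.
have z0 p : (p <= n)%N -> \sum_(0 <= j < p) rnorm (Uf_fun n f xi j) ^+ 2 = 0.
  move=> pn; rewrite big_nat_cond big1// => j /andP[/andP[_ jp] _].
  by rewrite /Uf_fun leqNgt (leq_trans jp pn)/= rnorm0 expr0n.
have [Nn|nN] := leqP N n; first by rewrite z0// t0.
rewrite (big_cat_nat (n := n))//=; last exact: ltnW.
rewrite z0// add0r -{1}[n]add0n big_addn.
rewrite [leRHS](big_cat_nat (n := N - n))//= ?leq_subr// -[leLHS]addr0.
rewrite lerD ?t0//; apply: ler_sum => k _.
rewrite /Uf_fun leq_addl addnK -exprMn ler_sqr ?nnegrE ?mulr_ge0 ?rnorm_ge0//.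
by rewrite (le_trans (rep_le _ _ _))// ler_wpM2r ?rnorm_ge0// iter_alpha_le.
Qed.

Lemma Uf_l2 n f xi : Uf_fun n f xi \in is_l2.
Proof. by apply/l2P; exists (rnorm f * rnorm xi) => N; exact: Uf_part. Qed.

Lemma Uf_bop n f : (fun xi => L2 _ (Uf_l2 n f xi)) \in is_bop.
Proof.
apply/bopP; split=> [a u v|]; last first.
  by exists (rnorm f) => xi; apply: l2norm_le; [exact: valP|exact: Uf_part].
apply/val_inj/funext => j; rewrite /= /Uf_fun.
rewrite -[RHS]/(a *: Uf_fun n f u j + Uf_fun n f v j) /Uf_fun.
by case: ifP => _; [exact: bop_linear|rewrite scaler0 addr0].
Qed.

Definition Uf n f : bop (l2 H) := Bop _ (Uf_bop n f).

(* [a n] is the coefficient of [U^n]. *)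
Definition l1 : set (nat -> C0 R X) :=
  [set a | cvgn (series (fun n => rnorm (a n)))].

Definition l1_rep (a : nat -> C0 R X) : bop (l2 H) :=
  limn (series (fun n => Uf n (a n))).

Definition semicrossed : set (bop (l2 H)) := closure (l1_rep @` l1).

(* The [n]th Fourier coefficient: the continuous extension to [semicrossed] of
   [l1_rep a |-> a n], i.e. the limit of [a n] as [l1_rep a] tends to [T]. *)
Definition fourier n (T : bop (l2 H)) : C0 R X :=
  lim (filter_from (nbhs T) (fun W => (fun a => a n) @` (l1 `&` l1_rep @^-1` W))).

End semicrossed_product.

Definition metrizable (R : realType) (X : topologicalType) : Prop :=
  exists d : X -> X -> R,
    [/\ forall x y, d x y = 0 <-> x = y,
        forall x y, d x y = d y x,
        forall x y z, d x z <= d x y + d y z &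
        forall x, nbhs x =
          filter_from [set e : R | 0 < e] (fun e => [set y | d x y < e])].

Definition mult_op (R : realType) (V : normedModType R[i]) (A B T : bop V) :
  bop V := bop_comp (bop_comp A T) B.

(* Compactness of [F] as an operator from the subspace [E] to itself: as [V] is
   Hausdorff, the image of the unit ball of [E] is relatively compact in [E] iff
   it lies in a compact subset of [E]. *)
Definition compact_operator_on (R : realType) (V : normedModType R[i])
    (E : set V) (F : V -> V) : Prop :=
  exists2 K : set V, compact K /\ K `<=` E &
    forall v, E v -> `|v| <= 1 -> K (F v).

(* Main.v *)
Require Import Defs.
From HB Require Import structures.
From mathcomp Require Import all_boot all_order all_algebra complex.
From mathcomp Require Import all_classical all_reals all_analysis.
From mathcomp Require Import ring lra zify.

(** Throughout, [f_m] and [g_n] are the Fourier coefficients of [A] and [B], and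
[u_l] is the function [x |-> f_m (phi^(n+l) x) * g_n x].

An element of the semicrossed product acts on [H (x) l^2] by a lower triangular
matrix whose entries are the translates of its Fourier coefficients
([has_coefs_fourier]).  Hence the coefficients determine the operator, a product
has the twisted convolution of the coefficients of its factors
([has_coefs_comp]), and, as an injective representation of [C_0(X)] is isometric
([rep_isometry]), each coefficient is a contractive function of the operator.
The coefficient of [A (U^l h) B] at degree [q + l] is therefore
  [x |-> sum_(i <= q) f_(q-i) (phi^(l+i) x) * h (phi^i x) * g_i x].

From compactness to the conditions.  On a compact set of operators the
coefficients tend to 0 uniformly as the degree grows
([compact_fourier_vanish]), and the coefficients of bounded degree are
equicontinuous ([compact_fourier_equicontinuous]); both follow from finite
nets.  Both are applied to [A (U^l h) B], where [h] is a bump equal to 1 at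
[phi^n y] and to 0 at the other points [phi^i y] with [i <= m + n].  The
coefficients at [y] are then the convolution of [j |-> f_j (phi^(n+l) y)] with
[i |-> h (phi^i y) * g_i y].  For a periodic [y] several terms survive, and
[u_l y] itself is recovered by [small_convolution]: bounded sequences with a
small convolution have small products, a quantitative form of the fact that
power series have no zero divisors.  Fixing [y] and letting [l] grow gives (b).
If [y <> x] is close to [x], the bump may also vanish at the points [phi^i x],
so that the coefficients are 0 at [x] and small at [y]: thus [u_l y] is small
for all [l] at once and all [y <> x] near [x], which gives (a) and (c).

From the conditions to compactness.  Compactness of [M_{A,B}] means that the
image of the unit ball has finite nets, a property that survives sums and uniform
limits.  Fejer means converge in norm ([fejer_approx]) and only involve the
coefficients of [A] and [B], so one may assume [A = U^m f] and [B = U^n g].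
The operator norm of [U^m f T U^n g] is controlled, uniformly in [T], by the
supremum of all the [|u_l|] ([mult_op_small]).  By (a) and (c) the points where
some [|u_l|] exceeds a given threshold are isolated and do not accumulate, so,
[g] vanishing at infinity, they form a finite set; with (b), [f] and [g] can be
replaced up to a small error by finite combinations of point masses.  For point
masses at [y] and [x], a coefficient of [U^m 1_y T U^n 1_x] can only be nonzero
at an [l] with [phi^(n+l) x = y].  If there is at most one such [l], the image
is one-dimensional; otherwise [y] is periodic, and (b) forces the scalar
[f y * g x] in front of this term to vanish. *)

Set Implicit Arguments.
Unset Strict Implicit.
Unset Printing Implicit Defensive.

Import Order.TTheory GRing.Theory Num.Theory.
Import numFieldNormedType.Exports.

Local Open Scope classical_set_scope.
Local Open Scope ring_scope.
Local Open Scope complex_scope.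

(** * Norm topology in terms of real epsilons *)

Section rnorm_topology.
Context {R : realType} {V : normedModType R[i]}.
Implicit Types (v w : V) (A : set V).

Lemma rnorm_distC v w : rnorm (v - w) = rnorm (w - v).
Proof. by rewrite -rnormN opprB. Qed.

Lemma rnorm_triangle u v w : rnorm (u - w) <= rnorm (u - v) + rnorm (v - w).
Proof. by rewrite -[u - w](subrKA v); exact: rnormD. Qed.

Lemma rnorm_sum_le I (r : seq I) (P : pred I) (F : I -> V) :
  rnorm (\sum_(i <- r | P i) F i) <= \sum_(i <- r | P i) rnorm (F i).
Proof.
elim/big_rec2: _ => [|i x y _ h]; first by rewrite rnorm0.
by rewrite (le_trans (rnormD _ _))// lerD.
Qed.

Lemma rnorm_dist_small_eq v w : (forall e : R, 0 < e -> rnorm (v - w) <= e) -> v = w.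
Proof.
move=> h; apply/eqP; rewrite -subr_eq0; apply/eqP/rnorm0_eq0/eqP.
by rewrite eq_le rnorm_ge0 andbT; apply/ler_addgt0Pr => e e0; rewrite add0r h.
Qed.

Lemma rnorm_cvgP T (F : set_system T) {FF : Filter F} (f : T -> V) v :
  f @ F --> v <-> forall e : R, 0 < e -> \forall t \near F, rnorm (f t - v) <= e.
Proof.
split=> [/cvgrPdist_le fv e e0|fv].
  have /fv : 0 < e%:C by rewrite ltcR.
  by apply: filterS => t; rewrite -rnormE lecR rnorm_distC.
apply/cvgrPdist_le => e e0.
have eE : (complex.Re e)%:C = e by rewrite RRe_real// gtr0_real.
have /fv : 0 < complex.Re e by rewrite -ltcR eE.
by apply: filterS => t; rewrite -rnormE -eE lecR rnorm_distC.
Qed.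

Lemma nbhs_rnormP v (W : set V) :
  nbhs v W <-> exists2 e : R, 0 < e & forall w, rnorm (w - v) <= e -> W w.
Proof.
split=> [/nbhs_ballP[e /= e0 vW]|[e e0 vW]].
  have eE : (complex.Re e)%:C = e by rewrite RRe_real// gtr0_real.
  have re0 : 0 < complex.Re e by rewrite -ltcR eE.
  exists (complex.Re e / 2); first by rewrite divr_gt0.
  move=> w wv; apply: vW; rewrite -ball_normE/= -rnormE -eE ltcR rnorm_distC.
  by rewrite (le_lt_trans wv)// ltr_pdivrMr// ltr_pMr// ltr1n.
have : id @ nbhs v --> v by exact: cvg_id.
move=> /rnorm_cvgP/(_ _ e0); exact: filterS.
Qed.

Lemma closure_rnormP A v : closure A v <->
  forall e : R, 0 < e -> exists2 w, A w & rnorm (w - v) <= e.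
Proof.
split=> [Av e e0|Av W /nbhs_rnormP[e e0 vW]].
  have /Av[w [Aw wv]] : nbhs v [set w | rnorm (w - v) <= e].
    by apply/nbhs_rnormP; exists e => //.
  by exists w.
by have [w Aw wv] := Av e e0; exists w; split => //; exact: vW.
Qed.

Lemma compact_net A : compact A -> forall e : R, 0 < e ->
  exists2 s : seq V, {subset s <= A} &
    forall v, A v -> exists2 w, w \in s & rnorm (v - w) <= e.
Proof.
rewrite compact_cover => cA e e0.
pose B (w : V) := [set v : V | rnorm (v - w) <= e]°.
have [||D' D'A AD'] := cA V A B.
- by move=> w _; exact: open_interior.
- move=> v Av; exists v => //; apply/nbhs_rnormP; exists e => //.
exists (finmap.enum_fset D') => [w /D'A//|v /AD'[w /= wD' /interior_subset/= vw]].
by exists w.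
Qed.

End rnorm_topology.

(** * Finite nets, compactness and completeness *)

(** The usual notion of a Cauchy filter, with real radii; stating it with centres
    makes it directly usable with finite nets. *)
Definition rnorm_cauchy (R : realType) (V : normedModType R[i]) (F : set_system V) :=
  forall e : R, 0 < e -> exists v, F [set w | rnorm (w - v) <= e].

(** Completeness as a property of a given norm, so that it can be proved of
    operator spaces and of [C_0(X)] without building further instances. *)
Definition rnorm_complete (R : realType) (V : normedModType R[i]) :=
  forall F : set_system V, ProperFilter F -> rnorm_cauchy F -> exists v : V, F --> v.

Definition rnorm_net (R : realType) (V : normedModType R[i]) (A : set V) (e : R) :=
  exists s : seq V, forall v, A v -> exists2 w, w \in s & rnorm (v - w) <= e.

Lemma ultra_mem_seq (I : eqType) (T : Type) (F : set_system T) (s : seq I)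
    (P : I -> set T) : UltraFilter F ->
  F [set t | exists2 i, i \in s & P i t] -> exists2 i, i \in s & F (P i).
Proof.
move=> FF; elim: s => [|i s ih] Fs.
  by have [t []] := filter_ex Fs.
have [FP|FP] := in_ultra_setVsetC (P i) FF; first by exists i; rewrite ?mem_head.
have /ih[j js FPj] : F [set t | exists2 i, i \in s & P i t].
  apply: filterS (filterI Fs FP) => t [[j]]; rewrite inE => /orP[/eqP->//|js] Pj _.
  by exists j.
by exists j => //; rewrite inE js orbT.
Qed.

Section complete.
Context {R : realType}.

(** Total boundedness in a complete space: an ultrafilter on the closure picks
    one ball of each net, hence is Cauchy. *)
Lemma net_compact_closure (V : normedModType R[i]) (A : set V) :
  rnorm_complete V -> (forall e : R, 0 < e -> rnorm_net A e) -> compact (closure A).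
Proof.
move=> cV nA; rewrite compact_ultra => F FF FA.
have [|v Fv] := cV F _.
  move=> e e0; have e20 : 0 < e / 2 by rewrite divr_gt0.
  have [s sP] := nA _ e20.
  have : F [set v | exists2 w, w \in s & rnorm (v - w) <= e].
    apply: filterS FA => v /closure_rnormP/(_ _ e20)[u /sP[w ws uw] uv].
    exists w => //; rewrite (splitr e) (le_trans (rnorm_triangle v u w))// lerD//.
    by rewrite rnorm_distC.
  by move=> /ultra_mem_seq[w ws Fw]; exists w.
exists v; split => //=.
move: (@closed_closure _ A); rewrite closure_id => ->.
move=> W vW; have FW : F W by exact: Fv.
by have [w ?] := filter_ex (filterI FA FW); exists w.
Qed.

Lemma complete_rnorm_complete (V : completeNormedModType R[i]) : rnorm_complete V.
Proof.
move=> F FF Fc; exists (lim F); apply: cauchy_cvg; apply: cauchy_exP => e e0.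
have eE : (complex.Re e)%:C = e by rewrite RRe_real// gtr0_real.
have re0 : 0 < complex.Re e by rewrite -ltcR eE.
have [|v vF] := Fc (complex.Re e / 2); first by rewrite divr_gt0.
exists v; apply: filterS vF => w /= wv; rewrite -ball_normE/= -rnormE -eE ltcR.
by rewrite rnorm_distC (le_lt_trans wv)// ltr_pdivrMr// ltr_pMr// ltr1n.
Qed.

(** The real and imaginary parts are contractions to the complete space [R]. *)
Lemma complex_rnorm_complete : rnorm_complete R[i].
Proof.
move=> F FF Fc.
have Rec (z w : R[i]) : `|complex.Re z - complex.Re w| <= rnorm (z - w).
  case: z w => [a b] [c d]; rewrite /rnorm normc_def/=.
  by rewrite -sqrtr_sqr ler_wsqrtr// lerDl sqr_ge0.
have Imc (z w : R[i]) : `|complex.Im z - complex.Im w| <= rnorm (z - w).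
  case: z w => [a b] [c d]; rewrite /rnorm normc_def/=.
  by rewrite -sqrtr_sqr ler_wsqrtr// lerDr sqr_ge0.
have cvgc (p : R[i] -> R) : (forall z w, `|p z - p w| <= rnorm (z - w)) ->
    cvg (p @ F).
  move=> pc; apply: cauchy_cvg; apply: cauchy_exP => e e0.
  have [|v vF] := Fc (e / 2); first by rewrite divr_gt0.
  exists (p v); suff : F (p @^-1` ball (p v) e) by [].
  apply: filterS vF => w /= wv; apply: (@le_lt_trans _ _ (rnorm (v - w))) => //.
  by rewrite rnorm_distC (le_lt_trans wv)// ltr_pdivrMr// ltr_pMr// ltr1n.
exists (lim (@complex.Re R @ F) +i* lim (@complex.Im R @ F)).
apply/(@rnorm_cvgP _ _ _ F _ id) => e e0.
have e20 : 0 < e / 2 by rewrite divr_gt0.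
have /cvgrPdist_le/(_ _ e20) h1 := cvgc _ Rec.
have /cvgrPdist_le/(_ _ e20) h2 := cvgc _ Imc.
have cE (z : R[i]) a b :
    z - (a +i* b) = (complex.Re z - a)%:C + 'i * (complex.Im z - b)%:C.
  by case: z => x y; simpc.
near=> z; rewrite cE.
rewrite (splitr e) (le_trans (rnormD _ _))// lerD//.
  by rewrite rnorm_real distrC; near: z.
rewrite rnormM rnorm_real distrC.
have -> : rnorm ('i : R[i]) = 1 by rewrite /rnorm normc_def/= expr0n expr1n add0r sqrtr1.
by rewrite mul1r; near: z.
Unshelve. all: by end_near. Qed.

Lemma is_C0_closed (X : topologicalType) (g : X -> R[i]) :
  (forall e : R, 0 < e -> exists2 f, f \in is_C0 & forall x, rnorm (f x - g x) <= e) ->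
  g \in is_C0.
Proof.
move=> gP; apply/asboolP; split=> [x|e e0].
  apply/rnorm_cvgP => e e0; have e30 : 0 < e / 3 by rewrite divr_gt0.
  have [f /asboolP[cf _] fg] := gP _ e30.
  have /rnorm_cvgP/(_ _ e30) := cf x; apply: filterS => y fyx.
  have -> : e = e / 3 + (e / 3 + e / 3) by field.
  apply: le_trans (rnorm_triangle _ (f y) _) _; apply: lerD.
    by rewrite rnorm_distC.
  by apply: le_trans (rnorm_triangle _ (f x) _) _; exact: lerD.
have e30 : 0 < e / 2 by rewrite divr_gt0.
have [f /asboolP[_ /(_ _ e30)[K cK Kf]] fg] := gP _ e30.
exists K => // x /Kf fx; rewrite (splitr e).
rewrite -(subrK (f x) (g x)) (le_lt_trans (rnormD _ _))// ler_ltD//.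
by rewrite rnorm_distC.
Qed.

Lemma C0_dist_le (X : topologicalType) (f g : C0 R X) (e : R) : 0 <= e ->
  (forall x, rnorm (f x - g x) <= e) -> rnorm (f - g) <= e.
Proof. by move=> e0 fg; apply: supnorm_le. Qed.

Lemma C0_norm_le (X : topologicalType) (f : C0 R X) (e : R) : 0 <= e ->
  (forall x, rnorm (f x) <= e) -> rnorm f <= e.
Proof. exact: supnorm_le. Qed.

Lemma C0_rnorm_complete (X : topologicalType) : rnorm_complete (C0 R X).
Proof.
move=> F FF Fc.
have gP x : exists z : R[i], (fun f : C0 R X => f x) @ F --> z.
  have [|z Fz] := @complex_rnorm_complete ((fun f : C0 R X => f x) @ F) _; last by exists z.
  move=> e /Fc[f fF]; exists (f x).
  suff : F [set h : C0 R X | rnorm (h x - f x) <= e] by [].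
  by apply: filterS fF => h /= hf; exact: le_trans (C0_le (h - f) x) hf.
have [g gF] := choice gP.
have near_g (f : C0 R X) (e : R) : 0 < e -> F [set w | rnorm (w - f) <= e] ->
    forall x, rnorm (f x - g x) <= e + e.
  move=> e0 fF x; have /rnorm_cvgP/(_ _ e0) := gF x.
  move=> /(filterI fF)/filter_ex[h [/= hf hg]].
  rewrite (le_trans (rnorm_triangle _ (h x) _))// lerD//.
  by rewrite rnorm_distC (le_trans (C0_le (h - f) x)).
have g0 : g \in is_C0.
  apply: is_C0_closed => e e0; have e20 : 0 < e / 2 by rewrite divr_gt0.
  have [f fF] := Fc _ e20; exists f; first exact: valP.
  by move=> x; rewrite [leRHS]splitr; exact: near_g.
exists (MkC0 _ g0); apply/(@rnorm_cvgP _ _ _ F _ id) => e e0.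
have e30 : 0 < e / 3 by rewrite divr_gt0.
have [f fF] := Fc _ e30; apply: filterS (fF) => h /= hf.
have -> : e = e / 3 + (e / 3 + e / 3) by field.
rewrite (le_trans (rnorm_triangle _ f _))// lerD//.
by apply: C0_dist_le; [rewrite addr_ge0// ltW|exact: near_g].
Qed.

End complete.

(** * Operators on square-summable sequences *)

Lemma sum_ord_mono (R : realType) (F : nat -> R) m n : (m <= n)%N ->
  (forall k, 0 <= F k) -> \sum_(k < m) F k <= \sum_(k < n) F k.
Proof.
move=> mn F0; rewrite -(subnKC mn) big_split_ord/= lerDl.
by apply: sumr_ge0 => k _; exact: F0.
Qed.

Lemma sum_ord_trunc_le (R : realType) n N (F : nat -> R) : (forall k, 0 <= F k) ->
  \sum_(k < n) (if (k < N)%N then F k else 0) <= \sum_(k < N) F k.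
Proof.
move=> F0; suff -> : \sum_(k < n) (if (k < N)%N then F k else 0) =
    \sum_(k < minn n N) F k by apply: sum_ord_mono => //; exact: geq_minr.
elim: n => [|n ih]; first by rewrite min0n !big_ord0.
rewrite big_ord_recr/= ih; case: ltnP => nN; last first.
  by rewrite addr0 (minn_idPr (leqW nN)).
by rewrite (minn_idPl nN) big_ord_recr.
Qed.

Section l2_bop.
Context {R : realType} {V : normedModType R[i]}.
Implicit Types (v w : l2 V) (S T : bop (l2 V)).

Lemma l2part_sqr n (w : nat -> V) :
  l2part n w ^+ 2 = \sum_(k < n) rnorm (w k) ^+ 2.
Proof. by rewrite sqr_sqrtr// sumr_ge0// => k _; exact: sqr_ge0. Qed.

Lemma l2part_leP n (w : nat -> V) (M : R) : 0 <= M ->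
  (l2part n w <= M) = (\sum_(k < n) rnorm (w k) ^+ 2 <= M ^+ 2).
Proof. by move=> M0; rewrite -l2part_sqr ler_sqr// nnegrE l2part_ge0. Qed.

Lemma l2part_le v n : l2part n v <= rnorm v.
Proof. by apply: l2norm_ge; exact: valP. Qed.

Lemma l2part_norm_le v (M : R) : (forall n, l2part n v <= M) -> rnorm v <= M.
Proof. by move=> vM; apply: l2norm_le => //; exact: valP. Qed.

Lemma l2_norm_ge v n : \sum_(k < n) rnorm (v k) ^+ 2 <= rnorm v ^+ 2.
Proof. by rewrite -l2part_leP ?rnorm_ge0// l2part_le. Qed.

Lemma l2_norm_le v (M : R) : 0 <= M ->
  (forall n, \sum_(k < n) rnorm (v k) ^+ 2 <= M ^+ 2) -> rnorm v <= M.
Proof. by move=> M0 vM; apply: l2part_norm_le => n; rewrite l2part_leP. Qed.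

Lemma l2_coord_le v k : rnorm (v k) <= rnorm v.
Proof.
rewrite -ler_sqr ?nnegrE ?rnorm_ge0// (le_trans _ (l2_norm_ge v k.+1))//.
by rewrite big_ord_recr/= lerDr sumr_ge0// => i _; exact: sqr_ge0.
Qed.

(** Controls finitely many coordinates by coordinatewise estimates, which is how
    pointwise limits of operators are compared with norm estimates. *)
Lemma l2part_le_sum n (w : nat -> V) : l2part n w <= \sum_(k < n) rnorm (w k).
Proof.
have s0 m : 0 <= \sum_(k < m) rnorm (w k) by apply: sumr_ge0 => k _; exact: rnorm_ge0.
rewrite l2part_leP//; elim: n => [|n ih]; first by rewrite !big_ord0 expr0n.
rewrite !big_ord_recr/= sqrrD -addrA addrC [leRHS]addrC.
by rewrite lerD// ?lerDr// -?addrA ?lerDr; move: (s0 n) (rnorm_ge0 (w n)) ih; nra.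
Qed.

Lemma bop_norm_le T (M : R) : 0 <= M ->
  (forall v, rnorm (T v) <= M * rnorm v) -> rnorm T <= M.
Proof. exact: opnorm_le. Qed.

Lemma bop_comp_le S T : rnorm (bop_comp S T) <= rnorm S * rnorm T.
Proof.
apply: bop_norm_le => [|v]; first by rewrite mulr_ge0// rnorm_ge0.
rewrite -mulrA (le_trans (bop_le S _))// ler_wpM2l ?rnorm_ge0//; exact: bop_le.
Qed.

Lemma bopD S T v : (S + T) v = S v + T v. Proof. by []. Qed.
Lemma bopB S T v : (S - T) v = S v - T v. Proof. by []. Qed.
Lemma bopZ (z : R[i]) T v : (z *: T) v = z *: T v. Proof. by []. Qed.
Lemma l2D v w k : (v + w) k = v k + w k. Proof. by []. Qed.
Lemma l2B v w k : (v - w) k = v k - w k. Proof. by []. Qed.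
Lemma l2Z (z : R[i]) v k : (z *: v) k = z *: v k. Proof. by []. Qed.

Lemma bop_sum I (r : seq I) (P : pred I) (F : I -> bop (l2 V)) v :
  (\sum_(i <- r | P i) F i) v = \sum_(i <- r | P i) F i v.
Proof. by elim/big_rec2: _ => [//|i y T _ <-]. Qed.

Lemma bop_ext S T : (forall v k, S v k = T v k) -> S = T.
Proof.
by move=> h; apply/val_inj/funext => v; apply/val_inj/funext => k; exact: h.
Qed.

Lemma bop_coord_le T v k : rnorm (T v k) <= rnorm T * rnorm v.
Proof. exact: le_trans (l2_coord_le _ _) (bop_le _ _). Qed.

(** The limit is taken entry by entry, directly in [V]; the Cauchy estimate, valid
    on each finite block of coordinates, passes to the limit there, and letting the
    block grow gives both boundedness of the limit and convergence in norm. *)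
Lemma bop_rnorm_complete : rnorm_complete V -> rnorm_complete (bop (l2 V)).
Proof.
move=> cV F FF Fc.
have LP (p : l2 V * nat) : exists z : V, (fun T : bop (l2 V) => T p.1 p.2) @ F --> z.
  have [|z Fz] := cV ((fun T : bop (l2 V) => T p.1 p.2) @ F) _; last by exists z.
  move=> e e0; have M0 : 0 < rnorm p.1 + 1 by rewrite ltr_wpDl ?rnorm_ge0.
  have [|S FS] := Fc (e / (rnorm p.1 + 1)); first by rewrite divr_gt0.
  exists (S p.1 p.2).
  suff : F [set T : bop (l2 V) | rnorm (T p.1 p.2 - S p.1 p.2) <= e] by [].
  apply: filterS FS => T /= TS.
  rewrite -l2B -bopB; apply: le_trans (bop_coord_le (T - S) p.1 p.2) _.
  apply: le_trans (ler_wpM2r (rnorm_ge0 _) TS) _.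
  by rewrite mulrAC ler_pdivrMr// ler_wpM2l ?lerDl// ltW.
have [L0 LF0] := choice LP; pose L v k := L0 (v, k).
have LF v k : (fun T : bop (l2 V) => T v k) @ F --> L v k by exact: LF0 (v, k).
have near_L S (e : R) : F [set T | rnorm (T - S) <= e] ->
    forall v n, l2part n (fun k => L v k - S v k) <= e * rnorm v.
  move=> FS v n; apply/ler_addgt0Pr => d d0.
  have d'0 : 0 < d / n.+1%:R by rewrite divr_gt0.
  have : F [set T : bop (l2 V) | forall k : 'I_n, rnorm (T v k - L v k) <= d / n.+1%:R].
    apply: filter_forall => k.
    by have /rnorm_cvgP/(_ _ d'0) := LF v k.
  move=> /(filterI FS)/filter_ex[T [/= TS TL]].
  have -> : (fun k => L v k - S v k) =
      (fun k => L v k - T v k) + (fun k => T v k - S v k) :> (nat -> V).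
    by apply/funext => k; rewrite -[RHS]/(L v k - T v k + (T v k - S v k)) subrKA.
  apply: le_trans (l2partD _ _ _) _; rewrite addrC; apply: lerD.
    have -> : (fun k => T v k - S v k) = ((T - S) v : nat -> V).
      by apply/funext => k; rewrite bopB l2B.
    apply: le_trans (l2part_le ((T - S) v) n) _; apply: le_trans (bop_le _ _) _.
    by rewrite ler_wpM2r ?rnorm_ge0.
  apply: le_trans (l2part_le_sum _ _) _.
  apply: (@le_trans _ _ (\sum_(k < n) d / n.+1%:R)).
    by apply: ler_sum => k _; rewrite rnorm_distC.
  rewrite sumr_const card_ord -[_ *+ _]mulr_natr mulrAC ler_pdivrMr// ler_pM2l//.
  by rewrite ler_nat.
have [S FS] := Fc 1 ltr01.
have Lb v n : l2part n (L v) <= (1 + rnorm S) * rnorm v.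
  have -> : L v = (fun k => L v k - S v k) + (S v : nat -> V).
    by apply/funext => k; rewrite -[RHS]/(L v k - S v k + S v k) subrK.
  rewrite (le_trans (l2partD _ _ _))// mulrDl lerD ?near_L//.
  exact: le_trans (l2part_le _ _) (bop_le _ _).
have Ll2 v : L v \in is_l2 by apply/l2P; exists ((1 + rnorm S) * rnorm v).
have Lbop : (fun v => L2 _ (Ll2 v)) \in is_bop.
  apply/bopP; split=> [a u v|].
    apply/val_inj/funext => k /=.
    suff h : (fun T : bop (l2 V) => T (a *: u + v) k) @ F --> a *: L u k + L v k.
      exact: (cvg_unique (@norm_hausdorff _ _) (LF _ _) h).
    under eq_fun do rewrite bop_linear l2D l2Z.
    by apply: cvgD; [apply: cvgZr|]; exact: LF.
  by exists (1 + rnorm S) => v; apply: l2norm_le => //=.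
exists (Bop _ Lbop); apply/(@rnorm_cvgP _ _ _ F _ id) => e e0.
have e20 : 0 < e / 2 by rewrite divr_gt0.
have [U FU] := Fc _ e20; apply: filterS (FU) => T /= TU.
rewrite (splitr e) (le_trans (rnorm_triangle _ U _))// lerD// rnorm_distC.
apply: bop_norm_le; first exact: ltW.
by move=> v; apply: l2part_norm_le => n; exact: near_L.
Qed.


Lemma l2fin_subproof N (w : nat -> V) : (fun k => if (k < N)%N then w k else 0) \in is_l2.
Proof.
apply/l2P; exists (l2part N w) => n; rewrite l2part_leP ?l2part_ge0// l2part_sqr.
apply: le_trans (sum_ord_trunc_le (F := fun k => rnorm (w k) ^+ 2) n N _);
  last by move=> k; exact: sqr_ge0.
by apply: ler_sum => k _; case: ifP => // _; rewrite rnorm0 expr0n.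
Qed.

(** Finitely supported vectors, used both for the copy of [V] in degree 0 and for
    the windows of the Fejer means. *)
Definition l2fin N (w : nat -> V) : l2 V := L2 _ (l2fin_subproof N w).

Lemma l2fin_norm N (w : nat -> V) : rnorm (l2fin N w) ^+ 2 <= \sum_(k < N) rnorm (w k) ^+ 2.
Proof.
rewrite -l2part_sqr ler_sqr ?nnegrE ?rnorm_ge0 ?l2part_ge0//.
apply: l2part_norm_le => n; rewrite l2part_leP ?l2part_ge0// l2part_sqr.
apply: le_trans (sum_ord_trunc_le (F := fun k => rnorm (w k) ^+ 2) n N _);
  last by move=> k; exact: sqr_ge0.
by apply: ler_sum => k _ /=; case: ifP => // _; rewrite rnorm0 expr0n.
Qed.

End l2_bop.

(** * The semicrossed product as a closed algebra *)

(** The choice of constants that makes the product of a bounded factor and a small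
    factor at most [e / 2], with no case distinction on [z = 0]. *)
Lemma half_eps (R : realType) (z e : R) : 0 <= z -> 0 < e ->
  z * (e / (2 * (z + 1))) <= e / 2.
Proof.
move=> z0 e0; have z1 : 0 < 2 * (z + 1) by rewrite mulr_gt0// ltr_wpDl.
by rewrite mulrA ler_pdivrMr//; nra.
Qed.


Lemma sum_ord_shift_le (R : realType) N n (F : nat -> R) : (forall k, 0 <= F k) ->
  \sum_(j < N) (if (n <= j)%N then F (j - n)%N else 0) <= \sum_(k < N) F k.
Proof.
move=> F0; suff -> : \sum_(j < N) (if (n <= j)%N then F (j - n)%N else 0) =
    \sum_(k < N - n) F k by apply: sum_ord_mono => //; exact: leq_subr.
elim: N => [|N ih]; first by rewrite sub0n !big_ord0.
rewrite big_ord_recr/= ih; case: leqP => nN.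
  by rewrite subSn// big_ord_recr.
by rewrite addr0 (eqP nN) (eqP (ltnW nN)) !big_ord0.
Qed.

Section C0_algebra.
Context {R : realType} {X : topologicalType}.
Implicit Types f g : C0 R X.

Lemma C0_ext f g : (forall x, f x = g x) -> f = g.
Proof. by move=> h; apply/val_inj/funext => x; exact: h. Qed.

Lemma C0D f g x : (f + g) x = f x + g x. Proof. by []. Qed.
Lemma C0B f g x : (f - g) x = f x - g x. Proof. by []. Qed.
Lemma C0Z (z : R[i]) f x : (z *: f) x = z * f x. Proof. by []. Qed.
Lemma C0M f g x : C0_mul f g x = f x * g x. Proof. by []. Qed.
Lemma C0J f x : C0_conj f x = (f x)^*. Proof. by []. Qed.

Lemma C0_sum I (r : seq I) (P : pred I) (F : I -> C0 R X) x :
  (\sum_(i <- r | P i) F i) x = \sum_(i <- r | P i) F i x.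
Proof. by elim/big_rec2: _ => [//|i y g _ <-]. Qed.

Lemma iter_alpha_linear (phi : homeo X) n (a : R[i]) f g :
  iter n (alpha phi) (a *: f + g) = a *: iter n (alpha phi) f + iter n (alpha phi) g.
Proof. by apply: C0_ext => x; rewrite C0D C0Z !iter_alphaE. Qed.

End C0_algebra.

Section Uf.
Context {R : realType} {X : topologicalType} {H : hilbert R}.
Variables (phi : homeo X) (rho : faithful_rep X H).
Implicit Types (f g : C0 R X).
Local Notation U := (Uf phi rho).
Local Notation al n := (iter n (alpha phi)).

Lemma UfE n f xi j :
  U n f xi j = if (n <= j)%N then rho (al (j - n) f) (xi (j - n)%N) else 0.
Proof. by []. Qed.

Lemma Uf_le n f : rnorm (U n f) <= rnorm f.
Proof.
apply: bop_norm_le => [|xi]; first exact: rnorm_ge0.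
apply: l2_norm_le => [|N]; first by rewrite mulr_ge0 ?rnorm_ge0.
rewrite exprMn; apply: le_trans (ler_wpM2l (sqr_ge0 _) (l2_norm_ge xi N)).
rewrite mulr_sumr.
apply: le_trans (@sum_ord_shift_le _ N n (fun k => rnorm f ^+ 2 * rnorm (xi k) ^+ 2) _);
  last by move=> k; rewrite mulr_ge0 ?sqr_ge0.
apply: ler_sum => j _; rewrite UfE; case: ifP => _; last by rewrite rnorm0 expr0n.
rewrite -exprMn ler_sqr ?nnegrE ?mulr_ge0 ?rnorm_ge0//.
by rewrite (le_trans (rep_le _ _ _))// ler_wpM2r ?rnorm_ge0// iter_alpha_le.
Qed.

Lemma Uf_linear n (a : R[i]) f g : U n (a *: f + g) = a *: U n f + U n g.
Proof.
apply: bop_ext => xi j; rewrite bopD l2D bopZ l2Z !UfE.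
case: ifP => _; last by rewrite scaler0 addr0.
by rewrite iter_alpha_linear rep_linear.
Qed.

HB.instance Definition _ n :=
  GRing.isLinear.Build R[i] (C0 R X) (bop (l2 H)) *:%R (U n) (@Uf_linear n).

(** The relation defining the multiplication of [l^1(Z_+, C_0(X))]; it makes the
    semicrossed product an algebra. *)
Lemma Uf_comp n m f g :
  bop_comp (U n f) (U m g) = U (n + m) (C0_mul (al m f) g).
Proof.
apply: bop_ext => xi j; rewrite [LHS]UfE [RHS]UfE.
have [nj|jn] := leqP n j; last first.
  by rewrite ifF//; apply/negbTE; rewrite -ltnNge ltn_addr.
rewrite UfE leq_subRL//; case: ifP => nmj; last first.
  by rewrite linear0.
rewrite subnDA; have mj : (m <= j - n)%N by rewrite leq_subRL.
have -> : al (j - n - m) (C0_mul (al m f) g) =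
    C0_mul (al (j - n) f) (al (j - n - m) g).
  by apply: C0_ext => x; rewrite C0M !iter_alphaE C0M iter_alphaE -iterD subnKC.
by rewrite rep_mul.
Qed.

Lemma Uf_bop_complete : rnorm_complete (bop (l2 H)).
Proof. by apply: bop_rnorm_complete; exact: complete_rnorm_complete. Qed.

(** The defining series converges because it is dominated by the norms of its
    terms and the space of operators is complete. *)
Lemma l1_repP (a : nat -> C0 R X) : l1 a ->
  series (fun n => U n (a n)) @ \oo --> l1_rep phi rho a.
Proof.
move=> la; pose s := series (fun n => U n (a n)).
have [|T sT] := @Uf_bop_complete (s @ \oo) _.
  move=> e e0.
  have /cvg_ex[/= l sl] := la.
  have e20 : 0 < e / 2 by rewrite divr_gt0.
  have /cvgrPdist_le/(_ _ e20)[N _ NP] := sl.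
  exists (s N); suff : \forall n \near \oo, rnorm (s n - s N) <= e by [].
  exists N => // n /= Nn; rewrite /s sub_series_geq//.
  apply: le_trans (rnorm_sum_le _ _ _) _.
  apply: (@le_trans _ _ (\sum_(N <= k < n) rnorm (a k))).
    by apply: ler_sum => k _; exact: Uf_le.
  rewrite -sub_series_geq// (splitr e).
  apply: le_trans (ler_norm _) _.
  rewrite -(subrKA l) (le_trans (ler_normD _ _))// lerD//.
    by rewrite distrC NP.
  by rewrite NP/=.
suff <- : T = l1_rep phi rho a by [].
by apply/esym; apply: (cvg_lim (@norm_hausdorff _ _) sT).
Qed.

Lemma l1_lin (a b : nat -> C0 R X) (z : R[i]) : l1 a -> l1 b -> l1 (fun n => z *: a n + b n).
Proof.
move=> la lb; rewrite /l1/=.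
apply: (@series_le_cvg _ _ (fun n => rnorm z * rnorm (a n) + rnorm (b n))).
- by move=> n; exact: rnorm_ge0.
- by move=> n; rewrite addr_ge0// ?mulr_ge0 ?rnorm_ge0.
- by move=> n; rewrite (le_trans (rnormD _ _))// rnormZ.
- by apply: is_cvg_seriesD => //; exact: is_cvg_seriesZ.
Qed.

Lemma l1_rep_linear (a b : nat -> C0 R X) (z : R[i]) : l1 a -> l1 b ->
  l1_rep phi rho (fun n => z *: a n + b n) = z *: l1_rep phi rho a + l1_rep phi rho b.
Proof.
move=> la lb; have := l1_repP (l1_lin (z := z) la lb).
move=> /(cvg_unique (@norm_hausdorff _ _)); apply.
have -> : series (fun n => U n (z *: a n + b n)) =
    (fun n => z *: series (fun n => U n (a n)) n + series (fun n => U n (b n)) n).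
  apply/funext => n; rewrite /series/= scaler_sumr -big_split/=.
  by apply: eq_bigr => k _; rewrite linearP.
by apply: cvgD; [apply: cvgZr|]; exact: l1_repP.
Qed.

Lemma l1_delta n f : l1 (fun k => if k == n then f else 0).
Proof.
apply/cvg_ex; exists (rnorm f); apply/cvgrPdist_le => e e0; near=> m.
rewrite /series/= (bigD1_seq n)/= ?iota_uniq ?mem_index_iota//=; last first.
  by near: m; exists n.+1.
rewrite eqxx big1 => [|k /negbTE ->]; last by rewrite rnorm0.
by rewrite addr0 subrr normr0 ltW.
Unshelve. all: by end_near. Qed.

Lemma l1_rep_delta n f : l1_rep phi rho (fun k => if k == n then f else 0) = U n f.
Proof.
have := l1_repP (@l1_delta n f); move/(cvg_unique (@norm_hausdorff _ _)); apply.
apply/rnorm_cvgP => e e0; near=> m.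
rewrite /series/= (bigD1_seq n)/= ?iota_uniq ?mem_index_iota//=; last first.
  by near: m; exists n.+1.
rewrite eqxx big1 => [|k /negbTE ->]; last by rewrite linear0.
by rewrite addr0 subrr rnorm0 ltW.
Unshelve. all: by end_near. Qed.

Lemma semicrossed_lin S T (z : R[i]) : semicrossed phi rho S -> semicrossed phi rho T ->
  semicrossed phi rho (z *: S + T).
Proof.
move=> /closure_rnormP hS /closure_rnormP hT; apply/closure_rnormP => e e0.
have z0 : 0 < 2 * (rnorm z + 1) by rewrite mulr_gt0// ltr_wpDl ?rnorm_ge0.
have [|_ [a la <-] aS] := hS (e / (2 * (rnorm z + 1))); first by rewrite divr_gt0.
have [|_ [b lb <-] bT] := hT (e / 2); first by rewrite divr_gt0.
exists (l1_rep phi rho (fun n => z *: a n + b n)).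
  by exists (fun n => z *: a n + b n) => //; exact: l1_lin.
rewrite l1_rep_linear// opprD addrACA -scalerBr.
apply: le_trans (rnormD _ _) _; rewrite (splitr e); apply: lerD; last exact: bT.
rewrite rnormZ; apply: le_trans (ler_wpM2l (rnorm_ge0 z) aS) _.
by apply: half_eps => //; exact: rnorm_ge0.
Qed.

Lemma semicrossed_Uf n f : semicrossed phi rho (U n f).
Proof.
apply: subset_closure; exists (fun k => if k == n then f else 0).
  exact: l1_delta.
exact: l1_rep_delta.
Qed.

Lemma semicrossed0 : semicrossed phi rho 0.
Proof. by have := @semicrossed_Uf 0 0; rewrite linear0. Qed.

Lemma semicrossed_sum I (r : seq I) (P : pred I) (F : I -> bop (l2 H)) :
  (forall i, P i -> semicrossed phi rho (F i)) ->
  semicrossed phi rho (\sum_(i <- r | P i) F i).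
Proof.
move=> FP; elim/big_rec: _ => [|i T Pi hT]; first exact: semicrossed0.
by rewrite -[F i]scale1r; apply: semicrossed_lin => //; exact: FP.
Qed.

(** Finite sums of monomials are dense, as partial sums of absolutely convergent
    series. *)
Lemma semicrossed_approx T (e : R) : semicrossed phi rho T -> 0 < e ->
  exists N, exists a : nat -> C0 R X, rnorm (\sum_(k < N) U k (a k) - T) <= e.
Proof.
move=> /closure_rnormP hT e0; have e20 : 0 < e / 2 by rewrite divr_gt0.
have [_ [a la <-] aT] := hT _ e20.
have /rnorm_cvgP/(_ _ e20)[N _ /(_ _ (leqnn N)) aN] := l1_repP la.
exists N, a; apply: le_trans (rnorm_triangle _ (l1_rep phi rho a) _) _.
rewrite (splitr e); apply: lerD aT.
by move: aN; rewrite /series/= big_mkord.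
Qed.

Lemma semicrossed_closed T :
  (forall e : R, 0 < e -> exists2 S, semicrossed phi rho S & rnorm (S - T) <= e) ->
  semicrossed phi rho T.
Proof. by move=> h; apply: closed_closure; apply/closure_rnormP. Qed.

Lemma bop_comp_suml I (r : seq I) (P : pred I) (F : I -> bop (l2 H)) T :
  bop_comp (\sum_(i <- r | P i) F i) T = \sum_(i <- r | P i) bop_comp (F i) T.
Proof.
by apply: bop_ext => v k; rewrite bop_sum/= !bop_sum.
Qed.

Lemma bop_comp_sumr I (r : seq I) (P : pred I) (F : I -> bop (l2 H)) T :
  bop_comp T (\sum_(i <- r | P i) F i) = \sum_(i <- r | P i) bop_comp T (F i).
Proof.
by apply: bop_ext => v k; rewrite bop_sum/= bop_sum linear_sum.
Qed.

Lemma bop_compBl S S' T :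
  bop_comp (S - S') T = bop_comp S T - bop_comp S' T :> bop (l2 H).
Proof. by apply: bop_ext. Qed.

Lemma bop_compBr S T T' :
  bop_comp S (T - T') = bop_comp S T - bop_comp S T' :> bop (l2 H).
Proof. by apply: bop_ext => v k; rewrite -[LHS]/(S (T v - T' v) k) linearB. Qed.

Lemma semicrossed_comp S T : semicrossed phi rho S -> semicrossed phi rho T ->
  semicrossed phi rho (bop_comp S T).
Proof.
move=> hS hT; apply: semicrossed_closed => e e0.
have T0 : 0 < 2 * (rnorm T + 1) by rewrite mulr_gt0// ltr_wpDl ?rnorm_ge0.
have [|N [a aS]] := semicrossed_approx (e := e / (2 * (rnorm T + 1))) hS.
  by rewrite divr_gt0.
set S' := (\sum_(k < N) _) in aS.
have S0 : 0 < 2 * (rnorm S' + 1) by rewrite mulr_gt0// ltr_wpDl ?rnorm_ge0.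
have [|M [b bT]] := semicrossed_approx (e := e / (2 * (rnorm S' + 1))) hT.
  by rewrite divr_gt0.
set T' := (\sum_(k < M) _) in bT.
exists (bop_comp S' T').
  rewrite bop_comp_suml; apply: semicrossed_sum => i _.
  rewrite bop_comp_sumr; apply: semicrossed_sum => j _.
  by rewrite Uf_comp; exact: semicrossed_Uf.
apply: le_trans (rnorm_triangle _ (bop_comp S' T) _) _.
rewrite -bop_compBl -bop_compBr (splitr e); apply: lerD.
  apply: le_trans (bop_comp_le _ _) _.
  apply: le_trans (ler_wpM2l (rnorm_ge0 _) bT) _.
  by apply: half_eps => //; exact: rnorm_ge0.
apply: le_trans (bop_comp_le _ _) _.
apply: le_trans (ler_wpM2r (rnorm_ge0 _) aS) _.
by rewrite mulrC; apply: half_eps => //; exact: rnorm_ge0.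
Qed.

End Uf.

(** * Faithful representations are isometric *)

Section isometry.
Context {R : realType} {X : topologicalType} {H : hilbert R}.
Variables (phi : homeo X) (rho : faithful_rep X H).
Implicit Types (f g : C0 R X).
Local Notation U := (Uf phi rho).
Local Notation al n := (iter n (alpha phi)).

Lemma rep_sq f v :
  ((rnorm (rho f v)) ^+ 2)%:C = hdot v (rho (C0_mul (C0_conj f) f) v).
Proof. by rewrite rep_mul/= rmorphXn/= rnormE -hdotE rep_conj. Qed.

(** The only form in which positivity in [C_0(X)] is used: sums of squares are
    sent to sums of squared norms. *)
Lemma rep_norm_sq_add f g h v :
  C0_mul (C0_conj f) f = C0_mul (C0_conj g) g + C0_mul (C0_conj h) h ->
  rnorm (rho f v) ^+ 2 = rnorm (rho g v) ^+ 2 + rnorm (rho h v) ^+ 2.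
Proof.
move=> fgh; apply: complexI; rewrite [RHS]rmorphD/= !rep_sq fgh.
by rewrite [rho (_ + _)]linearD -[(rho _ + rho _) v]/(rho _ v + rho _ v) linearDr.
Qed.

(** Suppose [r < |f x0|], and let [g] be the positive part of [|f|^2 - r^2] and
    [k = g^(3/2)].  Then [|f g|^2 = (r g)^2 + k^2], so that
    [|rho (f g) v|^2 = |rho (r g) v|^2 + |rho k v|^2], whereas the bound on [rho f]
    gives [|rho (f g) v| <= |rho (r g) v|].  Hence [rho k = 0] and [k = 0] by
    faithfulness, contradicting [g x0 > 0]. *)
Lemma rep_isometry f (r : R) : 0 <= r ->
  (forall v, rnorm (rho f v) <= r * rnorm v) -> rnorm f <= r.
Proof.
move=> r0 fr; apply: C0_norm_le => // x0; rewrite leNgt; apply/negP => rx0.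
pose g x : R := Num.max 0 (rnorm (f x) ^+ 2 - r ^+ 2).
have g0 x : 0 <= g x by rewrite le_max lexx.
have gf x : g x <= rnorm f * rnorm (f x).
  rewrite ge_max mulr_ge0 ?rnorm_ge0//= lerBlDr (le_trans (y := rnorm f * rnorm (f x)))//.
    by rewrite expr2 ler_wpM2r ?rnorm_ge0 ?C0_le.
  by rewrite lerDl sqr_ge0.
have cg : continuous g.
  move=> x; apply: (@continuous_max _ _ (cst 0) (fun x => rnorm (f x) ^+ 2 - r ^+ 2)).
    exact: cvg_cst.
  apply: cvgB; last exact: cvg_cst.
  have cf : {for x, continuous (fun y => rnorm (f y))}.
    by apply: continuous_comp; [exact: C0_continuous|exact: rnorm_continuous].
  exact: cvgM.
have gC0 : (fun x => (g x)%:C) \in is_C0.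
  apply: (C0_dominated (M := rnorm f) (valP f)) => x.
    by apply: continuous_comp; [exact: cg|exact: real_complex_continuous].
  by rewrite rnorm_real ger0_norm.
pose G : C0 R X := MkC0 _ gC0.
pose k x : R := g x * Num.sqrt (g x).
have kC0 : (fun x => (k x)%:C) \in is_C0.
  apply: (C0_dominated (M := Num.sqrt (rnorm G)) (valP G)) => x.
    apply: (@continuous_comp _ _ _ k); last exact: real_complex_continuous.
    apply: cvgM; first exact: cg.
    by apply: continuous_comp; [exact: cg|exact: sqrt_continuous].
  rewrite /= !rnorm_real normrM mulrC ler_wpM2r ?normr_ge0//.
  rewrite ger0_norm ?sqrtr_ge0// ler_wsqrtr//.
  by have := C0_le G x; rewrite rnorm_real ger0_norm.
pose K : C0 R X := MkC0 _ kC0.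
have fGK : C0_mul (C0_conj (C0_mul f G)) (C0_mul f G) =
    C0_mul (C0_conj (r%:C *: G)) (r%:C *: G) + C0_mul (C0_conj K) K.
  apply: C0_ext => x; rewrite C0D !C0M !C0J !C0M !C0Z.
  have cE (z : R[i]) : z^* * z = (rnorm z ^+ 2)%:C.
    by rewrite rmorphXn/= rnorm_norm mulrC sqr_normc.
  rewrite (cE (f x * G x)) (cE (r%:C * G x)) (cE (K x)) -rmorphD/=; congr (_%:C).
  rewrite !rnormM !rnorm_real (ger0_norm r0) (ger0_norm (g0 x)).
  rewrite ger0_norm ?mulr_ge0 ?sqrtr_ge0// /k !exprMn sqr_sqrtr//.
  rewrite /g; case: lerP => _; first by ring.
  by rewrite expr0n/= !mulr0 add0r.
have K0 v : rho K v = 0.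
  apply: rnorm0_eq0; apply/eqP; rewrite -sqrf_eq0 eq_le sqr_ge0 andbT.
  rewrite -(lerD2l (rnorm (rho (r%:C *: G) v) ^+ 2)) -(rep_norm_sq_add _ fGK) addr0.
  rewrite ler_sqr ?nnegrE ?rnorm_ge0//.
  rewrite rep_mul/= (le_trans (fr _))// [rho (_ *: _)]linearZ -[(_ *: rho G) v]/(r%:C *: rho G v).
  by rewrite rnormZ rnorm_real ger0_norm.
have : K = 0.
  by apply: (@rep_inj _ _ _ rho); rewrite linear0; apply/val_inj/funext => v; exact: K0.
move=> /(congr1 (fun h : C0 R X => h x0)) /= /complexI/eqP.
have gx0 : 0 < g x0.
  by rewrite lt_max subr_gt0 ltr_sqr ?nnegrE ?rnorm_ge0// rx0 orbT.
by rewrite mulf_eq0 gt_eqF//= gt_eqF ?sqrtr_gt0.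
Qed.

End isometry.

(** * Fourier coefficients *)

Lemma tri_sum (V : nmodType) (p : nat) (F : nat -> nat -> V) :
  \sum_(j < p.+1) \sum_(k < j.+1) F j k =
  \sum_(k < p.+1) \sum_(i < (p - k).+1) F (k + i)%N k.
Proof.
elim: p => [|p ih]; first by rewrite !big_ord_recl !big_ord0.
rewrite big_ord_recr/= ih [in RHS]big_ord_recr/= subnn.
rewrite big_ord1 addn0 [X in _ + X = _]big_ord_recr/= addrA; congr (_ + _).
rewrite -big_split/=; apply: eq_bigr => k _.
have kp : (k <= p)%N by rewrite -ltnS.
by rewrite subSn// [RHS]big_ord_recr/= addnS subnKC.
Qed.

Section coefficients.
Context {R : realType} {X : topologicalType} {H : hilbert R}.
Variables (phi : homeo X) (rho : faithful_rep X H).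
Implicit Types (f g : C0 R X) (S T : bop (l2 H)) (a b c : nat -> C0 R X).
Local Notation U := (Uf phi rho).
Local Notation al n := (iter n (alpha phi)).

(** The matrix of [T] is lower triangular with entry [alpha^k (c_(p-k))] in row
    [p] and column [k].  As a relation, this is stable under algebraic operations and
    limits without any reference to how the coefficients are computed. *)
Definition has_coefs T c := forall v p,
  T v p = \sum_(k < p.+1) rho (al k (c (p - k)%N)) (v k).

Lemma repD f g v : rho (f + g) v = rho f v + rho g v.
Proof. by rewrite linearD. Qed.

Lemma repZ (z : R[i]) f v : rho (z *: f) v = z *: rho f v.
Proof. by rewrite linearZ. Qed.

Lemma rep0 v : rho 0 v = 0.
Proof. by rewrite linear0. Qed.

Lemma rep_sum I (r : seq I) (P : pred I) (F : I -> C0 R X) v :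
  rho (\sum_(i <- r | P i) F i) v = \sum_(i <- r | P i) rho (F i) v.
Proof. by elim/big_rec2: _ => [|i y g _ <-]; [exact: rep0|exact: repD]. Qed.

Lemma iter_alpha0 n : al n (0 : C0 R X) = 0.
Proof. by apply: C0_ext => x; rewrite iter_alphaE. Qed.

Lemma iter_alpha_sum n I (r : seq I) (P : pred I) (F : I -> C0 R X) :
  al n (\sum_(i <- r | P i) F i) = \sum_(i <- r | P i) al n (F i).
Proof.
apply: C0_ext => x; rewrite iter_alphaE !C0_sum.
by apply: eq_bigr => i _; rewrite iter_alphaE.
Qed.

Lemma has_coefs_Uf n f : has_coefs (U n f) (fun m => if m == n then f else 0).
Proof.
move=> v p; rewrite UfE; case: leqP => np.
  have kp : (p - n < p.+1)%N by rewrite ltnS leq_subr.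
  rewrite (bigD1 (Ordinal kp))//= subKn// eqxx big1 ?addr0// => k kn.
  rewrite ifF ?iter_alpha0 ?rep0//; apply/negbTE; apply: contra kn => /eqP nE.
  by apply/eqP/val_inj; rewrite /= -nE subKn// -ltnS.
rewrite big1// => k _; rewrite ifF ?iter_alpha0 ?rep0//.
by apply/negbTE; rewrite neq_ltn (leq_ltn_trans (leq_subr _ _) np).
Qed.

Lemma has_coefs_lin (z : R[i]) S T a b : has_coefs S a -> has_coefs T b ->
  has_coefs (z *: S + T) (fun n => z *: a n + b n).
Proof.
move=> Sa Tb v p; rewrite bopD l2D bopZ l2Z Sa Tb scaler_sumr -big_split/=.
by apply: eq_bigr => k _; rewrite iter_alpha_linear repD repZ.
Qed.

Lemma has_coefs0 : has_coefs 0 (fun=> 0).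
Proof. by move=> v p; rewrite big1// => k _; rewrite iter_alpha0 rep0. Qed.

Lemma has_coefsB S T a b : has_coefs S a -> has_coefs T b ->
  has_coefs (S - T) (fun n => a n - b n).
Proof.
move=> Sa Tb; have := has_coefs_lin (-1) Tb Sa.
rewrite scaleN1r addrC; congr has_coefs; apply/funext => n.
by rewrite scaleN1r addrC.
Qed.

Lemma has_coefs_sum (N : nat) (F : nat -> bop (l2 H)) (a : nat -> nat -> C0 R X) :
  (forall k, has_coefs (F k) (a k)) ->
  has_coefs (\sum_(k < N) F k) (fun n => \sum_(k < N) a k n).
Proof.
move=> Fa; elim: N => [|N ih].
  rewrite big_ord0; move: has_coefs0; congr has_coefs; apply/funext => n.
  by rewrite big_ord0.
rewrite big_ord_recr/= addrC; have := has_coefs_lin 1 (Fa N) ih.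
rewrite scale1r; congr has_coefs; apply/funext => n.
by rewrite scale1r big_ord_recr/= addrC.
Qed.

Lemma has_coefs_poly N a :
  has_coefs (\sum_(k < N) U k (a k)) (fun n => if (n < N)%N then a n else 0).
Proof.
have := has_coefs_sum N (fun k => has_coefs_Uf k (a k)); congr has_coefs.
apply/funext => n; case: ltnP => nN.
  rewrite (bigD1 (Ordinal nN))//= eqxx big1 ?addr0// => k kn.
  by rewrite ifF//; apply/negbTE; apply: contra kn => /eqP kn; apply/eqP/val_inj.
rewrite big1// => k _; rewrite ifF//; apply/negbTE.
by rewrite neq_ltn (leq_trans (ltn_ord k) nN) orbT.
Qed.

(** The first column of the matrix recovers the coefficients, and [rho] is
    isometric. *)
Lemma has_coefs_le T c n : has_coefs T c -> rnorm (c n) <= rnorm T.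
Proof.
move=> Tc; apply: (rep_isometry (rho := rho)) => [|xi]; first exact: rnorm_ge0.
pose v : l2 H := l2fin 1 (fun=> xi).
have -> : rho (c n) xi = T v n.
  rewrite Tc big_ord_recl/= big1 ?addr0 ?subn0// => k _.
  by rewrite linear0.
apply: le_trans (bop_coord_le _ _ _) _; rewrite ler_wpM2l ?rnorm_ge0//.
rewrite -ler_sqr ?nnegrE ?rnorm_ge0//.
by apply: le_trans (l2fin_norm 1 (fun=> xi)) _; rewrite big_ord1.
Qed.

Lemma has_coefs_dist_le S T a b n : has_coefs S a -> has_coefs T b ->
  rnorm (a n - b n) <= rnorm (S - T).
Proof. by move=> Sa Tb; exact: (has_coefs_le n (has_coefsB Sa Tb)). Qed.

Lemma has_coefs_inj T a b : has_coefs T a -> has_coefs T b -> a = b.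
Proof.
move=> Ta Tb; apply/funext => n; apply: rnorm_dist_small_eq => e e0.
by apply: le_trans (has_coefs_dist_le n Ta Tb) _; rewrite subrr rnorm0 ltW.
Qed.

Lemma has_coefs_ext S T c : has_coefs S c -> has_coefs T c -> S = T.
Proof. by move=> Sc Tc; apply: bop_ext => v k; rewrite Sc Tc. Qed.

(** An entry in row [p] involves finitely many coefficients, so closeness is only
    required of the coefficients up to [p]. *)
Lemma has_coefs_lim T c :
  (forall p (e : R), 0 < e -> exists S a, [/\ has_coefs S a, rnorm (S - T) <= e &
     forall n, (n <= p)%N -> rnorm (a n - c n) <= e]) ->
  has_coefs T c.
Proof.
move=> h v p; apply: rnorm_dist_small_eq => e e0.
pose M := rnorm v + \sum_(k < p.+1) rnorm (v k).
have M0 : 0 <= M.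
  by rewrite addr_ge0 ?rnorm_ge0// sumr_ge0// => k _; exact: rnorm_ge0.
have d0 : 0 < e / (M + 1) by rewrite divr_gt0// ltr_wpDl.
have [S [a [Sa ST ac]]] := h p _ d0.
apply: le_trans (rnorm_triangle _ (S v p) _) _.
apply: (@le_trans _ _ (e / (M + 1) * M)); last first.
  by rewrite mulrAC ler_pdivrMr ?ltr_wpDl// ler_wpM2l ?lerDl// ltW.
rewrite /M mulrDr; apply: lerD.
  rewrite -l2B -bopB; apply: le_trans (bop_coord_le _ _ _) _.
  by apply: ler_wpM2r; [exact: rnorm_ge0|rewrite rnorm_distC].
rewrite Sa -sumrB mulr_sumr; apply: le_trans (rnorm_sum_le _ _ _) _.
apply: ler_sum => k _.
have -> : rho (al k (a (p - k)%N)) (v k) - rho (al k (c (p - k)%N)) (v k) =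
    rho (al k (a (p - k)%N - c (p - k)%N)) (v k).
  have -> : a (p - k)%N - c (p - k)%N = (-1) *: c (p - k)%N + a (p - k)%N.
    by rewrite scaleN1r addrC.
  by rewrite iter_alpha_linear repD repZ scaleN1r addrC.
apply: le_trans (rep_le _ _ _) _; rewrite ler_wpM2r ?rnorm_ge0//.
apply: le_trans (iter_alpha_le _ _ _) _.
by apply: ac; exact: leq_subr.
Qed.

Lemma has_coefs_l1 a : l1 a -> has_coefs (l1_rep phi rho a) a.
Proof.
move=> la; apply: has_coefs_lim => p e e0.
have /rnorm_cvgP/(_ _ e0)[N _ NP] := @l1_repP _ _ _ phi rho a la.
have {NP} := NP (maxn N p.+1) (leq_maxl _ _).
rewrite /series/= big_mkord => aN.
exists (\sum_(k < maxn N p.+1) U k (a k)).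
exists (fun n => if (n < maxn N p.+1)%N then a n else 0); split => //.
  exact: has_coefs_poly.
by move=> n np; rewrite leq_max ltnS np orbT subrr rnorm0 ltW.
Qed.

(** Multiplication of the two triangular matrices; the sum over the intermediate
    index is reorganized by diagonals with [tri_sum]. *)
Lemma has_coefs_comp S T a b : has_coefs S a -> has_coefs T b ->
  has_coefs (bop_comp S T)
    (fun p => \sum_(k < p.+1) C0_mul (al k (a (p - k)%N)) (b k)).
Proof.
move=> Sa Tb v p; rewrite [LHS]Sa.
under eq_bigr do rewrite Tb linear_sum/=.
rewrite (tri_sum p (fun j k => rho (al j (a (p - j)%N)) (rho (al k (b (j - k)%N)) (v k)))).
apply: eq_bigr => k _; rewrite iter_alpha_sum rep_sum; apply: eq_bigr => i _.
rewrite addKn subnDA.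
have -> : al k (C0_mul (al i (a (p - k - i)%N)) (b i)) =
    C0_mul (al (k + i) (a (p - k - i)%N)) (al k (b i)).
  by apply: C0_ext => x; rewrite C0M !iter_alphaE C0M iter_alphaE addnC iterD.
by rewrite rep_mul.
Qed.

(** The filter whose limit defines the coefficient. *)
Let fourier_filter n T := filter_from (nbhs T)
  (fun W => (fun a : nat -> C0 R X => a n) @` (@l1 R X `&` l1_rep phi rho @^-1` W)).

(** The filter is Cauchy since coefficients are contractive on the dense
    subalgebra, and [C_0(X)] is complete. *)
Let fourier_cvg n T : semicrossed phi rho T ->
  fourier_filter n T --> fourier phi rho n T /\ ProperFilter (fourier_filter n T).
Proof.
move=> hT; have FF : ProperFilter (fourier_filter n T).
  apply: filter_from_proper.
    apply: filter_from_filter; first by exists setT; exact: filterT.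
    move=> W W' TW TW'; exists (W `&` W'); first exact: filterI.
    by move=> _ [a [la [aW aW']] <-]; split; exists a.
  by move=> W /hT[_ [[a la <-] aW]]; exists (a n), a.
split=> //; have [|l Fl] := @C0_rnorm_complete R X (fourier_filter n T) FF.
  move=> e e0; have e20 : 0 < e / 2 by rewrite divr_gt0.
  have TW : nbhs T [set S | rnorm (S - T) <= e / 2] by apply/nbhs_rnormP; exists (e / 2).
  have [_ [[a la <-] /= aT]] := hT _ TW.
  exists (a n), [set S | rnorm (S - T) <= e / 2] => // _ [b [lb /= bT] <-] /=.
  apply: le_trans (has_coefs_dist_le n (has_coefs_l1 lb) (has_coefs_l1 la)) _.
  apply: le_trans (rnorm_triangle _ T _) _; rewrite (splitr e).
  by apply: lerD; [exact: bT|rewrite rnorm_distC; exact: aT].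
by apply: cvgP Fl.
Qed.

Lemma fourier_dist_le a T n : l1 a -> semicrossed phi rho T ->
  rnorm (a n - fourier phi rho n T) <= rnorm (l1_rep phi rho a - T).
Proof.
move=> la hT; have [Fl FF] := fourier_cvg n hT.
apply/ler_addgt0Pr => e e0; have e20 : 0 < e / 2 by rewrite divr_gt0.
have /rnorm_cvgP/(_ _ e20)[W TW WP] : id @ fourier_filter n T --> fourier phi rho n T by [].
have TW' : nbhs T [set S | rnorm (S - T) <= e / 2] by apply/nbhs_rnormP; exists (e / 2).
have [_ [[b lb <-] [bW /= bT]]] := hT _ (filterI TW TW').
apply: le_trans (rnorm_triangle _ (b n) _) _; rewrite (splitr e) addrA; apply: lerD.
  apply: le_trans (has_coefs_dist_le n (has_coefs_l1 la) (has_coefs_l1 lb)) _.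
  apply: le_trans (rnorm_triangle _ T _) _; apply: lerD; first exact: lexx.
  by rewrite rnorm_distC; exact: bT.
by apply: WP; exists b.
Qed.

Lemma has_coefs_fourier T : semicrossed phi rho T ->
  has_coefs T (fun n => fourier phi rho n T).
Proof.
move=> hT; apply: has_coefs_lim => p e e0.
have /closure_rnormP/(_ _ e0)[_ [a la <-] aT] := hT.
exists (l1_rep phi rho a), a; split => //; first exact: has_coefs_l1.
by move=> n _; apply: le_trans (fourier_dist_le n la hT) _.
Qed.

Lemma fourier_eq T c n : semicrossed phi rho T -> has_coefs T c ->
  fourier phi rho n T = c n.
Proof. by move=> /has_coefs_fourier h Tc; rewrite (has_coefs_inj Tc h). Qed.

Lemma fourier_le T n : semicrossed phi rho T -> rnorm (fourier phi rho n T) <= rnorm T.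
Proof. by move=> /has_coefs_fourier h; exact: (has_coefs_le n h). Qed.

(** A finite sum at distance [e] has no coefficient of large degree. *)
Lemma fourier_vanish T (e : R) : semicrossed phi rho T -> 0 < e ->
  exists N, forall n, (N <= n)%N -> rnorm (fourier phi rho n T) <= e.
Proof.
move=> hT e0; have [N [a aT]] := semicrossed_approx hT e0.
exists N => n Nn.
have := has_coefs_dist_le n (has_coefs_poly N a) (has_coefs_fourier hT).
rewrite ltnNge Nn/= sub0r rnormN => h; exact: le_trans h aT.
Qed.

End coefficients.

(** * Small convolutions and bump functions *)

(** The square of [a_m b_n] is [a_m b_n] times the convolution at [m + n], minus
    the cross terms [a_m b_n a_(m+n-i) b_i] with [i != n].  Regrouped as
    [(a_m b_i) (a_(m+n-i) b_n)], each cross term contains a product whose total index is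
    smaller than [m + n], which is small by induction on the total index.  This is the
    proof that a product of nonzero power series is nonzero, made quantitative. *)
Lemma small_convolution (R : realType) (M : R) (N : nat) : 0 <= M ->
  forall e : R, 0 < e -> exists2 d : R, 0 < d & forall a b : nat -> R[i],
    (forall i, rnorm (a i) <= M) -> (forall i, rnorm (b i) <= M) ->
    (forall q, (q <= N)%N -> rnorm (\sum_(i < q.+1) a (q - i)%N * b i) <= d) ->
  forall m n, (m + n <= N)%N -> rnorm (a m * b n) <= e.
Proof.
move=> M0; elim: N => [|N ih] e e0.
  exists e => // a b _ _ /(_ 0%N (leqnn _)); rewrite big_ord1 => ab m n.
  by rewrite leqn0 addn_eq0 => /andP[/eqP-> /eqP->].
(* One term of size [M^2 e'] and at most [N + 2] cross terms of that size have to
   add up to at most [e^2]. *)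
pose K : R := N.+3%:R * (M ^+ 2 + 1).
have K0 : 0 < K by rewrite mulr_gt0// ltr_wpDl// sqr_ge0.
pose e' := e ^+ 2 / K; have e'0 : 0 < e' by rewrite divr_gt0// exprn_gt0.
have [|d d0 dP] := ih (Num.min e e'); first by rewrite lt_min e0.
exists (Num.min d e') => [|a b aM bM c m n]; first by rewrite lt_min d0.
have abN i j : (i + j <= N)%N -> rnorm (a i * b j) <= Num.min e e'.
  move=> ijN; apply: (dP a b aM bM) => // q qN.
  by apply: le_trans (c q (leqW qN)) _; rewrite ge_min lexx.
rewrite leq_eqVlt ltnS => /orP[/eqP mnN|/abN]; last first.
  by move/le_trans; apply; rewrite ge_min lexx.
have abM i j : rnorm (a i * b j) <= M ^+ 2.
  by rewrite rnormM expr2; apply: ler_pM => //; exact: rnorm_ge0.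
have cross i j k l : rnorm (a i * b j) <= e' -> rnorm (a i * b k * (a l * b j)) <= e' * M ^+ 2.
  move=> ij; have -> : a i * b k * (a l * b j) = (a i * b j) * (a l * b k) by ring.
  by rewrite rnormM; apply: ler_pM (abM _ _) => //; exact: rnorm_ge0.
have abe' i j : (i + j <= N)%N -> rnorm (a i * b j) <= e'.
  by move/abN/le_trans; apply; rewrite ge_min lexx orbT.
have nN : (n < N.+2)%N by rewrite ltnS -mnN leq_addl.
have : rnorm (a m * b n) ^+ 2 <= e ^+ 2.
  have -> : rnorm (a m * b n) ^+ 2 = rnorm (a m * b n * (a m * b n)).
    by rewrite [RHS]rnormM.
  have -> : a m * b n * (a m * b n) = a m * b n * (\sum_(i < N.+2) a (N.+1 - i)%N * b i)
     - \sum_(i < N.+2 | i != Ordinal nN) a m * b n * (a (N.+1 - i)%N * b i).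
    rewrite [X in _ = _ * X - _](bigD1 (Ordinal nN))//= mulrDr mulr_sumr addrK.
    by rewrite -mnN addnK.
  apply: le_trans (rnormD _ _) _; rewrite rnormN.
  apply: (@le_trans _ _ (M ^+ 2 * e' + N.+2%:R * (e' * M ^+ 2))).
    apply: lerD.
      rewrite rnormM; apply: ler_pM => //; do ?exact: rnorm_ge0.
      by apply: le_trans (c _ (leqnn _)) _; rewrite ge_min lexx orbT.
    apply: le_trans (rnorm_sum_le _ _ _) _.
    have -> : N.+2%:R * (e' * M ^+ 2) = \sum_(i < N.+2) e' * M ^+ 2.
      by rewrite sumr_const card_ord mulr_natl.
    rewrite [leRHS](bigD1 (Ordinal nN))//=.
    apply: ler_wpDl; first by rewrite mulr_ge0 ?sqr_ge0// ltW.
    apply: ler_sum => i; rewrite -val_eqE/= => inn.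
    case: (ltngtP i n) inn => // [iN|ni] _.
      have im : (m + i <= N)%N by lia.
      exact: cross (abe' _ _ im).
    rewrite [X in rnorm X]mulrC; apply: cross; apply: abe'.
    by have := ltn_ord i; lia.
  have -> : M ^+ 2 * e' + N.+2%:R * (e' * M ^+ 2) = (N.+3%:R * M ^+ 2) * e'.
    by rewrite -[N.+3%:R]natr1; ring.
  rewrite /e' mulrA ler_pdivrMr// mulrC ler_wpM2l ?sqr_ge0//.
  by rewrite ler_wpM2l// lerDl.
by rewrite ler_sqr ?nnegrE ?rnorm_ge0// ltW.
Qed.

Lemma metric_ge0 (R : realType) (X : Type) (d : X -> X -> R) :
  (forall x y, d x y = 0 <-> x = y) -> (forall x y, d x y = d y x) ->
  (forall x y z, d x z <= d x y + d y z) -> forall x y, 0 <= d x y.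
Proof.
move=> d0 dC dT u v; have := dT u v u.
by rewrite (dC v u) (d0 u u).2// -mulr2n pmulrn_lge0.
Qed.

Section metrizable.
Context {R : realType} {X : topologicalType}.
Hypothesis Xm : metrizable R X.

Lemma metrizable_near_neq (x p : X) : x <> p -> \forall y \near x, y <> p.
Proof.
have [d [d0 dC dT dN]] := Xm => xp.
suff : nbhs x [set y | y <> p] by [].
rewrite dN.
have dge0 := metric_ge0 d0 dC dT.
exists (d x p) => [|y /= xy yp]; last by rewrite yp ltxx in xy.
by rewrite /= lt_neqAle dge0 andbT eq_sym; apply/eqP => /d0.
Qed.

(** A tent function [max (0, 1 - d w / r)], with [r] below the distance from [w] to
    the points to be avoided and so small that the ball lies in a compact set. *)
Lemma C0_bump (Xlc : locally_compact [set: X]) (w : X) (s : seq X) :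
  exists h : C0 R X, [/\ rnorm h <= 1, h w = 1 &
    forall z, z \in s -> z <> w -> h z = 0].
Proof.
have [d [d0 dC dT dN]] := Xm.
have dge0 := metric_ge0 d0 dC dT.
have [K Kw [cK _]] := Xlc w I.
have [e e0 eK] : exists2 e : R, 0 < e & forall z, d w z < e -> K z.
  have : nbhs w K by apply: (@filterS _ (nbhs w)) Kw => z /(_ I).
  by rewrite dN => -[e e0 eK]; exists e.
have [r [r0 re rs]] : exists r : R, [/\ 0 < r, r <= e &
    forall z, z \in s -> z <> w -> r <= d w z].
  elim: s => [|z s [r [r0 re rs]]]; first by exists e.
  have [->|zw] := pselect (z = w).
    by exists r; split => // u; rewrite inE => /orP[/eqP->//|]; exact: rs.
  exists (Num.min r (d w z)); split.
  - rewrite lt_min r0/= lt_neqAle dge0 andbT eq_sym.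
    by apply/eqP => /d0 wz; apply: zw.
  - by rewrite ge_min re.
  - move=> u; rewrite inE => /orP[/eqP->|us] uw; rewrite ge_min ?lexx ?orbT//.
    by rewrite rs.
pose h z : R := Num.max 0 (1 - d w z / r).
have h0 z : r <= d w z -> h z = 0.
  by move=> rz; apply/max_idPl; rewrite subr_le0 ler_pdivlMr// mul1r.
have ch : continuous h.
  move=> z; apply: (@continuous_max _ _ (cst 0) (fun z => 1 - d w z / r)).
    exact: cvg_cst.
  apply: cvgB; first exact: cvg_cst.
  apply: cvgM; last exact: cvg_cst.
  apply/cvgrPdist_lt => f f0.
  suff : nbhs z [set v | `|d w z - d w v| < f] by [].
  rewrite dN; exists f => // v /= zv.
  apply: le_lt_trans zv; rewrite ler_norml.
  by have := dT w z v; have := dT w v z; rewrite (dC v z); lra.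
have hC0 : (fun z => (h z)%:C) \in @is_C0 R X.
  apply/asboolP; split=> [z|f f0].
    by apply: continuous_comp; [exact: ch|exact: real_complex_continuous].
  exists K => // z nKz; rewrite h0 ?rnorm0//.
  by rewrite leNgt; apply/negP => zr; apply: nKz; apply: eK; exact: lt_le_trans re.
exists (MkC0 _ hC0); split.
- apply: C0_norm_le => // z; rewrite rnorm_real ger0_norm ?le_max ?lexx//.
  by rewrite ge_max ler01/= gerBl divr_ge0// ltW.
- by rewrite /= /h (d0 w w).2// mul0r subr0 (max_idPr ler01).
- by move=> z zs zw /=; rewrite h0// rs.
Qed.

End metrizable.

Lemma near_all_seq (T : topologicalType) (I : eqType) (x : T) (s : seq I)
    (P : I -> T -> Prop) : (forall i, i \in s -> \forall y \near x, P i y) ->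
  \forall y \near x, forall i, i \in s -> P i y.
Proof.
elim: s => [|i s ih] sP; first by apply: nearW => y.
have /ih h1 : forall i, i \in s -> \forall y \near x, P i y.
  by move=> j js; apply: sP; rewrite inE js orbT.
have h2 := sP i (mem_head _ _).
near=> y => j; rewrite inE => /orP[/eqP->|]; first by near: y.
by move: j; near: y.
Unshelve. all: by end_near. Qed.

(** * Compact multiplications satisfy the conditions *)

Section necessity.
Context {R : realType} {X : topologicalType} {H : hilbert R}.
Variables (phi : homeo X) (rho : faithful_rep X H).
Implicit Types (S T : bop (l2 H)) (h : C0 R X).
Local Notation U := (Uf phi rho).
Local Notation E := (fourier phi rho).

(** Only degrees [q + l] occur, as [U^l h] raises degrees by [l]. *)
Lemma fourier_mult_op A B l h q x :
  semicrossed phi rho A -> semicrossed phi rho B ->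
  E (q + l) (mult_op A B (U l h)) x =
  \sum_(i < q.+1) E (q - i) A (iter (l + i) phi x) * (h (iter i phi x) * E i B x).
Proof.
move=> hA hB.
have hAU := has_coefs_comp (has_coefs_fourier hA) (has_coefs_Uf phi rho l h).
have := has_coefs_comp hAU (has_coefs_fourier hB).
move=> /fourier_eq ->; last first.
  by do ?apply: semicrossed_comp => //; exact: semicrossed_Uf.
rewrite C0_sum; pose G (k : nat) := C0_mul (iter k (alpha phi)
  (\sum_(j < (q + l - k).+1) C0_mul (iter j (alpha phi) (E (q + l - k - j) A))
     (if j == l :> nat then h else 0))) (E k B) x.
transitivity (\sum_(k < q.+1) G k + \sum_(k < l) G (q.+1 + k)%N).
  by rewrite -(big_split_ord _ xpredT (fun k : 'I_(q.+1 + l) => G k)).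
rewrite [X in _ + X]big1 ?addr0 => [|k _]; last first.
  rewrite /G C0M iter_alphaE C0_sum big1 ?mul0r// => j _.
  rewrite C0M ifF ?mulr0//; apply/negbTE.
  by have := ltn_ord k; have := ltn_ord j; case: j => j /= ? ? ?; apply/eqP; lia.
apply: eq_bigr => k _; rewrite /G.
have kq : (k <= q)%N by rewrite -ltnS.
rewrite C0M iter_alphaE C0_sum.
have lk : (l < (q + l - k).+1)%N by lia.
rewrite (bigD1 (Ordinal lk))// big1 => [|j jl]; last first.
  rewrite C0M ifF ?mulr0//; apply/negbTE.
  by apply: contra jl => /eqP jl; apply/eqP/val_inj.
rewrite /= addr0 eqxx iter_alphaE -iterD mulrA.
have -> : (q + l - k - l = q - k)%N by lia.
by [].
Qed.

(** Each operator of a finite net has coefficients tending to 0, and coefficients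
    are contractive. *)
Lemma compact_fourier_vanish (K : set (bop (l2 H))) (e : R) : compact K ->
  K `<=` semicrossed phi rho -> 0 < e ->
  exists N, forall p S, (N <= p)%N -> K S -> rnorm (E p S) <= e.
Proof.
move=> cK KA e0; have e20 : 0 < e / 2 by rewrite divr_gt0.
have [s sK sP] := compact_net cK e20.
have [N NP] : exists N, forall w, w \in s -> forall p, (N <= p)%N -> rnorm (E p w) <= e / 2.
  elim: s sK {sP} => [|w s ih] sK; first by exists 0%N.
  have [|N NP] := ih; first by move=> v vs; apply: sK; rewrite inE vs orbT.
  have wK : K w by apply/set_mem; apply: sK; rewrite mem_head.
  have [M MP] := fourier_vanish (KA _ wK) e20.
  exists (maxn N M) => v; rewrite inE => /orP[/eqP->|vs] p; rewrite geq_max => /andP[Np Mp].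
    exact: MP.
  exact: NP.
exists N => p S Np KS; have [w ws Sw] := sP _ KS.
have wK : K w by apply/set_mem; exact: sK.
rewrite -[E p S](subrK (E p w)) (splitr e).
apply: le_trans (rnormD _ _) _; apply: lerD; last exact: NP.
apply: le_trans Sw.
exact: (has_coefs_dist_le p (has_coefs_fourier (KA _ KS)) (has_coefs_fourier (KA _ wK))).
Qed.

(** Finitely many coefficients of the finitely many operators of a net are
    continuous at [x], and coefficients are contractive. *)
Lemma compact_fourier_equicontinuous (K : set (bop (l2 H))) (e : R) (x : X) (P : nat) : compact K ->
  K `<=` semicrossed phi rho -> 0 < e ->
  \forall y \near x, forall p S, (p < P)%N -> K S -> rnorm (E p S y - E p S x) <= e.
Proof.
move=> cK KA e0; have e30 : 0 < e / 3 by rewrite divr_gt0.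
have [s sK sP] := compact_net cK e30.
have : \forall y \near x, forall w, w \in s -> forall p : 'I_P,
    rnorm (E p w y - E p w x) <= e / 3.
  apply: near_all_seq => w ws; apply: filter_forall => p.
  by have /rnorm_cvgP/(_ _ e30) := @C0_continuous _ _ (E p w) x.
apply: filterS => y yP p S pP KS; have [w ws Sw] := sP _ KS.
have wK : K w by apply/set_mem; exact: sK.
have Sz z : rnorm (E p S z - E p w z) <= e / 3.
  rewrite -C0B; apply: le_trans (C0_le _ _) _; apply: le_trans Sw.
  exact: (has_coefs_dist_le p (has_coefs_fourier (KA _ KS)) (has_coefs_fourier (KA _ wK))).
have -> : e = e / 3 + (e / 3 + e / 3) by field.
apply: le_trans (rnorm_triangle _ (E p w y) _) _; apply: lerD; first exact: Sz.
apply: le_trans (rnorm_triangle _ (E p w x) _) _; apply: lerD.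
  exact: (yP _ ws (Ordinal pP)).
by rewrite rnorm_distC; exact: Sz.
Qed.

Section compact_mult.
Hypotheses (Xlc : locally_compact [set: X]) (Xm : metrizable R X).
Variables (A B : bop (l2 H)).
Hypotheses (hA : semicrossed phi rho A) (hB : semicrossed phi rho B).
Let f m := E m A.
Let g m := E m B.

(** With a bump [h] at [phi^n y], every surviving term of the coefficient of
    [A (U^l h) B] at [y] has [phi^i y = phi^n y], so that [f] is evaluated at
    [phi^(n+l) y] in all of them, and the coefficients at [y] form a convolution of
    scalar sequences to which [small_convolution] applies. *)
Let coef_product_small m n (e : R) : 0 < e -> exists2 d : R, 0 < d &
  forall l h y, rnorm h <= 1 -> h (iter n phi y) = 1 ->
    (forall i, (i <= m + n)%N -> iter i phi y <> iter n phi y -> h (iter i phi y) = 0) ->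
    (forall q, (q <= m + n)%N -> rnorm (E (q + l) (mult_op A B (U l h)) y) <= d) ->
  rnorm (f m (iter (n + l) phi y) * g n y) <= e.
Proof.
move=> e0; pose M := rnorm A + rnorm B.
have AM : rnorm A <= M by apply: ler_wpDr (rnorm_ge0 B) (lexx _).
have BM : rnorm B <= M by apply: ler_wpDl (rnorm_ge0 A) (lexx _).
have M0 : 0 <= M := le_trans (rnorm_ge0 A) AM.
have [d d0 dP] := small_convolution (m + n) M0 e0.
exists d => // l h y h1 hn hi hd.
pose a i := f i (iter (n + l) phi y); pose b i := h (iter i phi y) * g i y.
have -> : f m (iter (n + l) phi y) * g n y = a m * b n by rewrite /a/b hn mul1r.
apply: (dP a b) => // [i|i|q qmn].
- apply: le_trans (C0_le _ _) _; exact: le_trans (fourier_le _ hA) AM.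
- rewrite rnormM -[leRHS]mul1r; apply: ler_pM; do ?exact: rnorm_ge0.
    exact: le_trans (C0_le _ _) h1.
  apply: le_trans (C0_le _ _) _; exact: le_trans (fourier_le _ hB) BM.
- suff <- : E (q + l) (mult_op A B (U l h)) y = \sum_(i < q.+1) a (q - i)%N * b i.
    exact: hd.
  rewrite fourier_mult_op//; apply: eq_bigr => i _.
  have iq : (i <= q)%N by rewrite -ltnS.
  have [yi|yi] := pselect (iter i phi y = iter n phi y).
    by rewrite /a /b addnC [in RHS]addnC [in LHS]addnC !iterD yi.
  by rewrite /b hi ?mul0r ?mulr0// (leq_trans iq).
Qed.

Hypothesis cM : compact_operator_on (semicrossed phi rho) (mult_op A B).

Let U_unit l h : rnorm h <= 1 -> `|U l h| <= 1.
Proof.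
move=> h1; rewrite -[leRHS]/(1%:C) -rnorm_le; exact: le_trans (Uf_le _ _ _ _) h1.
Qed.

(** Here the point is fixed and the degree grows, so [compact_fourier_vanish]
    bounds all the coefficients that [coef_product_small] tests. *)
Lemma compact_mult_cvg0 m n x :
  (fun l => f m (iter (n + l) phi x) * g n x) @ \oo --> (0 : R[i]).
Proof.
have [K [cK KA] KM] := cM.
apply/rnorm_cvgP => e e0; have [d d0 dP] := coef_product_small m n e0.
have [N NP] := compact_fourier_vanish cK KA d0.
have [h [h1 hn hi]] := C0_bump Xm Xlc (iter n phi x) [seq iter i phi x | i <- iota 0 (m + n).+1].
exists N => // l /= Nl; rewrite subr0; apply: (dP l h) => // [i imn|q _].
  by apply: hi; apply: (map_f (fun i => iter i phi x)); rewrite mem_iota.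
apply: le_trans (C0_le _ _) _; apply: NP; first exact: leq_trans (leq_addl _ _).
by apply: KM; [exact: semicrossed_Uf|exact: U_unit].
Qed.

(** The common source of (a) and (c): the bump at [phi^n y] also avoids the points
    [phi^i x], so the test coefficients vanish at [x].  For [l] large they are small
    everywhere, and for the finitely many other [l] they are small near [x] by
    equicontinuity. *)
Lemma compact_mult_near m n x (e : R) : 0 < e ->
  \forall y \near x, y <> x -> forall l, rnorm (f m (iter (n + l) phi y) * g n y) <= e.
Proof.
move=> e0; have [K [cK KA] KM] := cM; have [d d0 dP] := coef_product_small m n e0.
have [N NP] := compact_fourier_vanish cK KA d0.
have phi_inj : injective (iter n phi).
  by elim: (n) => // k ih y z /= /(can_inj (homeo_funK phi))/ih.
have phi_surj y : exists z, iter n phi z = y.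
  elim: (n) y => [|k ih] y; first by exists y.
  by have [z zy] := ih (homeo_inv phi y); exists z; rewrite iterS zy homeo_invK.
(* The point [phi^n y] equals [phi^i x] for one [y] only, to be excluded for each of
   the finitely many [i] unless it is [x]. *)
have nears : \forall y \near x, forall i, i \in iota 0 (m + n).+1 ->
    y <> x -> iter i phi x <> iter n phi y.
  apply: near_all_seq => i _; have [z zi] := phi_surj (iter i phi x).
  have [xz|xz] := pselect (x = z).
    by apply: nearW => y yx; rewrite -zi => /phi_inj zy; apply: yx; rewrite xz zy.
  apply: filterS (metrizable_near_neq Xm xz) => y yz _.
  by rewrite -zi => /phi_inj/esym.
have := compact_fourier_equicontinuous x (m + n + N) cK KA d0.
apply: filterS2 nears => y ys yK yx l.
have [h [h1 hn hi]] := C0_bump Xm Xlc (iter n phi y)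
  ([seq iter i phi y | i <- iota 0 (m + n).+1] ++
   [seq iter i phi x | i <- iota 0 (m + n).+1]).
have KU : K (mult_op A B (U l h)).
  by apply: KM; [exact: semicrossed_Uf|exact: U_unit].
apply: (dP l h) => // [i imn|q qmn].
  by apply: hi; rewrite mem_cat (map_f (fun i => iter i phi y))// mem_iota.
have [Nq|qN] := leqP N (q + l).
  by apply: le_trans (C0_le _ _) _; exact: NP.
suff Ex0 : E (q + l) (mult_op A B (U l h)) x = 0.
  have := yK (q + l)%N _ _ KU; rewrite Ex0 subr0; apply.
  by apply: leq_trans qN _; exact: leq_addl.
rewrite fourier_mult_op// big1// => i _.
have iq : (i <= q)%N by rewrite -ltnS.
have is_ : val i \in iota 0 (m + n).+1 by rewrite mem_iota/= add0n ltnS (leq_trans iq).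
rewrite hi ?mul0r ?mulr0//; last exact: ys.
by rewrite mem_cat (map_f (fun i => iter i phi x) is_) orbT.
Qed.

(** At a limit point, [compact_mult_near] and the continuity of each function
    give the value 0, and then equicontinuity; at the other points equicontinuity is
    void. *)
Lemma compact_mult_conditions m n :
    [/\ forall (l : nat) (x : X), limit_point [set: X] x ->
          f m (iter (n + l) phi x) * g n x = 0,
        forall x : X, isolated [set: X] x ->
          (fun l : nat => f m (iter (n + l) phi x) * g n x) @ \oo --> (0 : R[i])
      & equicontinuous [set: nat]
          (fun (l : nat) (x : X) => f m (iter (n + l) phi x) * g n x)].
Proof.
have lim0 (l : nat) (x : X) : limit_point [set: X] x ->
    f m (iter (n + l) phi x) * g n x = 0.
  move=> xl; apply: rnorm_dist_small_eq => e e0; rewrite subr0.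
  pose u : C0 R X := C0_mul (iter (n + l) (alpha phi) (f m)) (g n).
  have uE y : u y = f m (iter (n + l) phi y) * g n y by rewrite C0M iter_alphaE.
  have e20 : 0 < e / 2 by rewrite divr_gt0.
  have /rnorm_cvgP/(_ _ e20) ux := @C0_continuous _ _ u x.
  have [y [/eqP yx _ [uyx uy]]] := xl _ (filterI ux (compact_mult_near m n x e20)).
  rewrite -uE -[u x](subrK (u y)) (splitr e).
  apply: le_trans (rnormD _ _) _; apply: lerD.
    by rewrite rnorm_distC.
  by rewrite uE; exact: uy.
split => // [x _|x V]; first exact: compact_mult_cvg0.
rewrite -entourage_ballE => -[e /= e0 eV].
have eE : (complex.Re e)%:C = e by rewrite RRe_real// gtr0_real.
have re0 : 0 < complex.Re e / 2 by rewrite divr_gt0// -ltcR eE.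
have [xl|xi] := pselect (limit_point [set: X] x).
  apply: filterS (compact_mult_near m n x re0) => y yP l _; apply: eV.
  have [->|yx] := pselect (y = x); first exact: ballxx.
  rewrite /= -ball_normE/= -rnormE -eE ltcR lim0// sub0r rnormN.
  apply: le_lt_trans (yP yx l) _.
  by rewrite ltr_pdivrMr ?ltr_pMr ?ltr1n// -ltcR eE.
rewrite not_limit_pointE in xi; case: xi => W xW Wx.
apply: filterS xW => y Wy l _.
have -> : y = x by apply: Wx.
apply: eV; exact: ballxx.
Qed.

End compact_mult.
End necessity.

(** * Fejer means *)

(** The Cauchy-Schwarz inequality against the constant sequence 1. *)
Lemma sqr_sum_le (R : realType) N (x : nat -> R) :
  (\sum_(r < N) x r) ^+ 2 <= N%:R * \sum_(r < N) x r ^+ 2.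
Proof.
elim: N => [|N ih]; first by rewrite !big_ord0 expr0n mul0r.
rewrite !big_ord_recr/=; set s := \sum_(r < N) x r in ih *.
have : 2 * (s * x N) <= \sum_(r < N) x r ^+ 2 + N%:R * x N ^+ 2.
  rewrite /s mulr_suml mulr_sumr mulr_natl.
  have -> : x N ^+ 2 *+ N = \sum_(r < N) x N ^+ 2 by rewrite sumr_const card_ord.
  rewrite -big_split/=; apply: ler_sum => r _.
  by have := sqr_ge0 (x r - x N); nra.
rewrite -[N.+1%:R]natr1 => h.
apply: (@le_trans _ _ (s ^+ 2 + 2 * (s * x N) + x N ^+ 2)).
  by rewrite sqrrD mulr_natl.
rewrite mulrDr mulrDl mul1r mulrDl mul1r.
by move: ih h; set t := \sum_(r < N) x r ^+ 2; lra.
Qed.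

Section fejer.
Context {R : realType} {X : topologicalType} {H : hilbert R}.
Variables (phi : homeo X) (rho : faithful_rep X H).
Implicit Types (T : bop (l2 H)) (c a : nat -> C0 R X).
Local Notation U := (Uf phi rho).
Local Notation al n := (iter n (alpha phi)).

(** The truncated subtraction makes the weight 0 beyond [N]. *)
Definition fejer_weight N m : R[i] := (N - m)%N%:R / N%:R.

Definition fejer N c : bop (l2 H) := \sum_(m < N) U m (fejer_weight N m *: c m).

Lemma has_coefs_fejer N c :
  has_coefs phi rho (fejer N c) (fun m => fejer_weight N m *: c m).
Proof.
have := has_coefs_poly phi rho N (fun m => fejer_weight N m *: c m).
congr has_coefs; apply/funext => m; case: ltnP => // Nm.
by rewrite /fejer_weight (eqP Nm) mul0r scale0r.
Qed.

Let window N (v : l2 H) s : l2 H :=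
  l2fin s.+1 (fun k => if (s < k + N)%N then v k else 0).

(** The Fejer mean averages the compressions of [T] to the windows of length [N]:
    the coordinates [k <= i] share exactly [N - (i - k)] of the windows that contain
    [i].  This replaces the average over the gauge action. *)
Let fejer_window N c T v i : (0 < N)%N -> has_coefs phi rho T c ->
  fejer N c v i = N%:R^-1 *: \sum_(r < N) T (window N v (i + r)) i.
Proof.
move=> N0 Tc; rewrite (has_coefs_fejer N c).
under [in RHS]eq_bigr do rewrite Tc.
rewrite exchange_big scaler_sumr/=; apply: eq_bigr => k _.
have ki : (k <= i)%N by rewrite -ltnS.
transitivity (N%:R^-1 *: \sum_(r < N) (if (r < N - (i - k))%N then
    rho (al k (c (i - k)%N)) (v k) else 0)).
  rewrite -big_mkcond/= -(big_ord_widen _ (fun=> rho (al k (c (i - k)%N)) (v k)) (leq_subr _ _)).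
  rewrite sumr_const card_ord -[X in _ = _ *: X]scaler_nat scalerA /fejer_weight.
  have -> : fejer_weight N (i - k) *: c (i - k)%N =
      fejer_weight N (i - k) *: c (i - k)%N + 0 by rewrite addr0.
  rewrite iter_alpha_linear iter_alpha0 addr0 repZ; congr (_ *: _).
  by rewrite mulrC.
congr (_ *: _); apply: eq_bigr => r _.
rewrite ltnS (leq_trans ki (leq_addr _ _)).
have -> : (i + r < k + N)%N = (r < N - (i - k))%N by lia.
by case: ifP => // _; rewrite linear0.
Qed.

Let sum_window_le M N (x : nat -> R) : (forall k, 0 <= x k) ->
  \sum_(s < M) \sum_(k < s.+1) (if (s < k + N)%N then x k else 0) <=
  N%:R * \sum_(k < M) x k.
Proof.
move=> x0; case: M => [|M]; first by rewrite !big_ord0 mulr0.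
rewrite (tri_sum M (fun s k => if (s < k + N)%N then x k else 0)) mulr_sumr.
apply: ler_sum => k _.
under eq_bigr do rewrite ltn_add2l.
apply: le_trans (@sum_ord_trunc_le _ _ N (fun=> x k) _) _ => //.
by rewrite sumr_const card_ord mulr_natl.
Qed.

Let sum_shift_le N M i (x : nat -> R) : (i + N <= M)%N -> (forall k, 0 <= x k) ->
  \sum_(r < N) x (i + r)%N <= \sum_(s < M) x s.
Proof.
move=> iNM x0; apply: le_trans (sum_ord_mono iNM x0).
by rewrite big_split_ord/= lerDr sumr_ge0.
Qed.

(** Contractivity of the window average: by Cauchy-Schwarz, the square of a
    coordinate is at most the average of the squares over the [N] windows containing it,
    and summing over all windows counts each coordinate of [v] at most [N] times. *)
Lemma fejer_le N c T : (0 < N)%N -> has_coefs phi rho T c ->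
  rnorm (fejer N c) <= rnorm T.
Proof.
move=> N0 Tc; apply: bop_norm_le => [|v]; first exact: rnorm_ge0.
apply: l2_norm_le => [|J]; first by rewrite mulr_ge0 ?rnorm_ge0.
have NR0 : 0 < N%:R :> R by rewrite ltr0n.
pose y s i := rnorm (T (window N v s) i) ^+ 2.
have y0 s i : 0 <= y s i by exact: sqr_ge0.
have step1 i : rnorm (fejer N c v i) ^+ 2 <= N%:R^-1 * \sum_(r < N) y (i + r)%N i.
  rewrite (fejer_window _ _ N0 Tc) rnormZ exprMn.
  have -> : rnorm (N%:R^-1 : R[i]) = N%:R^-1.
    have -> : (N%:R^-1 : R[i]) = (N%:R^-1)%:C by rewrite fmorphV/= rmorph_nat.
    by rewrite rnorm_real ger0_norm// invr_ge0 ltW.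
  rewrite expr2 -mulrA ler_wpM2l ?invr_ge0 ?(ltW NR0)// ler_pdivrMl//.
  apply: le_trans (sqr_sum_le N (fun r => rnorm (T (window N v (i + r)) i))).
  rewrite ler_sqr ?nnegrE ?rnorm_ge0 ?sumr_ge0//; first exact: rnorm_sum_le.
  by move=> r _; exact: rnorm_ge0.
apply: (@le_trans _ _ (N%:R^-1 * \sum_(s < J + N) \sum_(i < J) y s i)).
  rewrite exchange_big mulr_sumr/=; apply: ler_sum => i _.
  apply: le_trans (step1 i) _; rewrite ler_pM2l ?invr_gt0//.
  by apply: (@sum_shift_le _ _ _ (fun s => y s i)) => //; rewrite leq_add2r ltnW.
rewrite ler_pdivrMl// exprMn.
have window_le s : rnorm (window N v s) ^+ 2 <=
    \sum_(k < s.+1) (if (s < k + N)%N then rnorm (v k) ^+ 2 else 0).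
  apply: le_trans (l2fin_norm _ _) _; apply: ler_sum => k _.
  by case: ifP => // _; rewrite rnorm0 expr0n.
apply: (@le_trans _ _ (\sum_(s < J + N) rnorm T ^+ 2 * rnorm (window N v s) ^+ 2)).
  apply: ler_sum => s _; apply: le_trans (l2_norm_ge _ _) _.
  by rewrite -exprMn ler_sqr ?nnegrE ?mulr_ge0 ?rnorm_ge0//; exact: bop_le.
rewrite -mulr_sumr mulrCA ler_wpM2l ?sqr_ge0//.
apply: (@le_trans _ _ (\sum_(s < J + N) \sum_(k < s.+1)
    (if (s < k + N)%N then rnorm (v k) ^+ 2 else 0))).
  by apply: ler_sum => s _; exact: window_le.
apply: le_trans (@sum_window_le (J + N) N (fun k => rnorm (v k) ^+ 2) _) _.
  by move=> k; exact: sqr_ge0.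
by rewrite ler_pM2l//; exact: l2_norm_ge.
Qed.

Lemma fejerB N c a : fejer N (fun m => c m - a m) = fejer N c - fejer N a.
Proof.
by rewrite /fejer -sumrB; apply: eq_bigr => m _; rewrite scalerBr linearB.
Qed.

Lemma fejer_cvg_poly M a (e : R) : 0 < e -> exists2 N, (0 < N)%N &
  rnorm (fejer N (fun n => if (n < M)%N then a n else 0) - \sum_(k < M) U k (a k)) <= e.
Proof.
move=> e0; pose b := \sum_(k < M) M%:R * rnorm (a k).
have b0 : 0 <= b by apply: sumr_ge0 => k _; rewrite mulr_ge0 ?rnorm_ge0.
have [N0 N0P] : exists N, b <= e * N%:R.
  have := archi_boundP (divr_ge0 b0 (ltW e0)).
  move=> h; exists (Num.bound (b / e)); move: h => /ltW.
  by rewrite ler_pdivrMr// mulrC.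
pose N := maxn N0 M.+1.
have NM : (M <= N)%N by rewrite leq_max leqnSn orbT.
have N_gt0 : (0 < N)%N by rewrite leq_max orbT.
have NR0 : 0 < N%:R :> R by rewrite ltr0n.
exists N => //.
have -> : fejer N (fun n => if (n < M)%N then a n else 0) - \sum_(k < M) U k (a k) =
    \sum_(k < M) U k ((fejer_weight N k - 1) *: a k).
  have h1 := has_coefsB (has_coefs_fejer N (fun n => if (n < M)%N then a n else 0))
                        (has_coefs_poly phi rho M a).
  have h2 := has_coefs_poly phi rho M (fun k => (fejer_weight N k - 1) *: a k).
  apply: (has_coefs_ext h1); move: h2; congr has_coefs; apply/funext => n.
  by case: ifP => _; rewrite ?scaler0 ?subr0// scalerBl scale1r.
apply: le_trans (rnorm_sum_le _ _ _) _.
apply: (@le_trans _ _ (N%:R^-1 * b)); last first.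
  rewrite mulrC ler_pdivrMr// (le_trans N0P)// ler_wpM2l ?(ltW e0)// ler_nat.
  exact: leq_maxl.
rewrite mulr_sumr; apply: ler_sum => k _; apply: le_trans (Uf_le _ _ _ _) _.
rewrite rnormZ mulrA ler_wpM2r ?rnorm_ge0//.
have kN : (k <= N)%N by apply: leq_trans NM; exact: ltnW.
have -> : fejer_weight N k - 1 = (- (N%:R^-1 * k%:R))%:C.
  rewrite /fejer_weight natrB// mulrBl divff ?pnatr_eq0 -?lt0n//.
  by rewrite addrAC subrr sub0r rmorphN rmorphM fmorphV/= !rmorph_nat mulrC.
rewrite rnorm_real normrN ger0_norm ?mulr_ge0 ?invr_ge0 ?ler0n//.
by rewrite ler_pM2l ?invr_gt0// ler_nat ltnW.
Qed.

(** Contractivity transfers the convergence from finite sums to the whole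
    algebra. *)
Lemma fejer_approx T (e : R) : semicrossed phi rho T -> 0 < e ->
  exists N, rnorm (fejer N (fun m => fourier phi rho m T) - T) <= e.
Proof.
move=> hT e0; have e30 : 0 < e / 3 by rewrite divr_gt0.
have [M [a aT]] := semicrossed_approx hT e30.
have [N N0 NP] := fejer_cvg_poly M a e30.
set P := \sum_(k < M) _ in aT NP; set aM := (fun n => if _ then _ else _) in NP.
exists N; have -> : e = e / 3 + (e / 3 + e / 3) by field.
apply: le_trans (rnorm_triangle _ (fejer N aM) _) _; apply: lerD.
  rewrite -fejerB; have := has_coefsB (has_coefs_fourier hT) (has_coefs_poly phi rho M a).
  move=> /(fejer_le N0)/le_trans; apply.
  rewrite rnorm_distC; exact: aT.
apply: le_trans (rnorm_triangle _ P _) _; apply: lerD; first exact: NP.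
exact: aT.
Qed.

End fejer.

(** * Precompact families and multiplication by monomials *)

Lemma mult_opE (R : realType) (V : normedModType R[i]) (A B T : bop (l2 V)) :
  mult_op A B T = bop_comp A (bop_comp T B).
Proof. by apply: bop_ext. Qed.

Lemma mult_op_le (R : realType) (V : normedModType R[i]) (A B T : bop (l2 V)) :
  rnorm (mult_op A B T) <= rnorm A * rnorm T * rnorm B.
Proof.
apply: le_trans (bop_comp_le _ _) _.
by apply: ler_wpM2r (bop_comp_le _ _); exact: rnorm_ge0.
Qed.

Lemma mult_opDr (R : realType) (V : normedModType R[i]) (A B B' T : bop (l2 V)) :
  mult_op A (B + B') T = mult_op A B T + mult_op A B' T.
Proof.
apply: bop_ext => v k; rewrite -[LHS]/(A (T (B v + B' v)) k).
by rewrite [T _]linearD [A _]linearD.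
Qed.

Lemma mult_opDl (R : realType) (V : normedModType R[i]) (A A' B T : bop (l2 V)) :
  mult_op (A + A') B T = mult_op A B T + mult_op A' B T.
Proof. by apply: bop_ext. Qed.

(** Separates the error made on each factor. *)
Lemma mult_opB (R : realType) (V : normedModType R[i]) (A A' B B' T : bop (l2 V)) :
  mult_op A B T - mult_op A' B' T = mult_op A (B - B') T + mult_op (A - A') B' T.
Proof.
have -> : mult_op A B T = mult_op A (B - B') T + mult_op A B' T.
  by rewrite -mult_opDr subrK.
have -> : mult_op A B' T = mult_op (A - A') B' T + mult_op A' B' T.
  by rewrite -mult_opDl subrK.
by rewrite addrA addrK.
Qed.

Lemma mult_opZ (R : realType) (V : normedModType R[i]) (y z : R[i]) (A B T : bop (l2 V)) :
  mult_op (y *: A) (z *: B) T = (y * z) *: mult_op A B T.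
Proof.
apply: bop_ext => v k; rewrite -[LHS]/((y *: A (T (z *: B v))) k).
by rewrite [T _]linearZ [A _]linearZ scalerA.
Qed.

Lemma mult_op_sum (R : realType) (V : normedModType R[i]) I J (r : seq I) (s : seq J)
    (A : I -> bop (l2 V)) (B : J -> bop (l2 V)) T :
  mult_op (\sum_(i <- r) A i) (\sum_(j <- s) B j) T =
  \sum_(i <- r) \sum_(j <- s) mult_op (A i) (B j) T.
Proof.
elim: r => [|i r ih].
  rewrite !big_nil; apply: bop_ext => v k.
  by [].
rewrite !big_cons mult_opDl ih; congr (_ + _).
elim: s {ih} => [|j s ih]; last by rewrite !big_cons mult_opDr ih.
rewrite !big_nil; have := mult_opZ 1 0 (A i) 0 T.
by rewrite scale1r scaler0 mulr0 scale0r.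
Qed.

(** The unit disc lies in the continuous image of a compact square. *)
Lemma disc_net (R : realType) (e : R) : 0 < e ->
  exists s : seq R[i], forall z, rnorm z <= 1 -> exists2 w, w \in s & rnorm (z - w) <= e.
Proof.
move=> e0; pose c (p : R * R) : R[i] := p.1%:C + 'i * p.2%:C.
have cc : continuous c.
  move=> p; apply: cvgD.
    by apply: continuous_comp; [exact: cvg_fst|exact: real_complex_continuous].
  apply: cvgM; first exact: cvg_cst.
  by apply: continuous_comp; [exact: cvg_snd|exact: real_complex_continuous].
have cK : compact (c @` (`[-1, 1]%classic `*` `[-1, 1]%classic)).
  apply: continuous_compact; first exact: continuous_subspaceT.
  by apply: compact_setX; exact: segment_compact.
have [s _ sP] := compact_net cK e0.
exists s => z z1; apply: sP; case: z z1 => a b.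
rewrite /rnorm normc_def/= => ab1; exists (a, b); last first.
  by rewrite /c/=; simpc.
have h : a ^+ 2 + b ^+ 2 <= 1.
  have := ab1; rewrite -[leRHS]sqrtr1 ler_sqrt//.
have sq1 (x : R) : x ^+ 2 <= 1 -> -1 <= x <= 1.
  by move=> x1; apply/andP; split; nra.
by split; rewrite /= in_itv/=; apply: sq1; move: (sqr_ge0 a) (sqr_ge0 b) h; lra.
Qed.

Section nets.
Context {R : realType} {V : normedModType R[i]} {T : Type}.
Variable D : set T.
Implicit Types F G : T -> V.

(** Finite nets at all scales, rather than a compact closure: no limit has to be
    found in this form, which is stable under sums and uniform limits. *)
Definition precompact_on F := forall e : R, 0 < e -> rnorm_net (F @` D) e.

Lemma precompact_onD F G : precompact_on F -> precompact_on G ->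
  precompact_on (fun t => F t + G t).
Proof.
move=> hF hG e e0; have e20 : 0 < e / 2 by rewrite divr_gt0.
have [s sP] := hF _ e20; have [r rP] := hG _ e20.
exists [seq v + w | v <- s, w <- r] => _ [t Dt <-].
have [v vs Fv] := sP (F t) (imageP _ Dt); have [w wr Gw] := rP (G t) (imageP _ Dt).
exists (v + w); first exact: allpairs_f.
rewrite opprD addrACA (splitr e).
by apply: le_trans (rnormD _ _) _; exact: lerD.
Qed.

Lemma precompact_on_cst (v : V) : precompact_on (fun=> v).
Proof.
move=> e e0; exists [:: v] => _ [t Dt <-]; exists v; first exact: mem_head.
by rewrite subrr rnorm0 ltW.
Qed.

Lemma precompact_on_sum (I : eqType) (r : seq I) (F : I -> T -> V) :
  (forall i, i \in r -> precompact_on (F i)) ->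
  precompact_on (fun t => \sum_(i <- r) F i t).
Proof.
elim: r => [|i r ih] hF.
  under eq_fun do rewrite big_nil; exact: precompact_on_cst.
under eq_fun do rewrite big_cons; apply: precompact_onD.
  by apply: hF; exact: mem_head.
by apply: ih => j jr; apply: hF; rewrite inE jr orbT.
Qed.

Lemma precompact_onZ (z : R[i]) F : precompact_on F -> precompact_on (fun t => z *: F t).
Proof.
move=> hF e e0; have z1 : 0 < rnorm z + 1 by rewrite ltr_wpDl ?rnorm_ge0.
have [|s sP] := hF (e / (rnorm z + 1)); first by rewrite divr_gt0.
exists [seq z *: v | v <- s] => _ [t Dt <-].
have [v vs Fv] := sP (F t) (imageP _ Dt); exists (z *: v); first exact: map_f.
rewrite -scalerBr rnormZ; apply: le_trans (ler_wpM2l (rnorm_ge0 z) Fv) _.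
by rewrite mulrCA ger_pMr// ler_pdivrMr// mul1r lerDl.
Qed.

Lemma precompact_on_lim F :
  (forall e : R, 0 < e -> exists2 G, precompact_on G &
     forall t, D t -> rnorm (F t - G t) <= e) -> precompact_on F.
Proof.
move=> hF e e0; have e20 : 0 < e / 2 by rewrite divr_gt0.
have [G hG FG] := hF _ e20; have [s sP] := hG _ e20.
exists s => _ [t Dt <-]; have [v vs Gv] := sP (G t) (imageP _ Dt).
exists v => //; rewrite (splitr e).
by apply: le_trans (rnorm_triangle _ (G t) _) _; apply: lerD Gv; exact: FG.
Qed.

(** The coefficients of the family may depend on [t] in any way, so nothing like
    linearity is required to see that a one-dimensional image is precompact. *)
Lemma precompact_on_line (v : V) (z : T -> R[i]) :
  (forall t, D t -> rnorm (z t) <= 1) -> precompact_on (fun t => z t *: v).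
Proof.
move=> z1 e e0; have v1 : 0 < rnorm v + 1 by rewrite ltr_wpDl ?rnorm_ge0.
have [|s sP] := @disc_net R (e / (rnorm v + 1)); first by rewrite divr_gt0.
exists [seq w *: v | w <- s] => _ [t Dt <-].
have [w ws zw] := sP (z t) (z1 t Dt).
exists (w *: v); first exact: (map_f (fun w => w *: v)).
rewrite -scalerBl rnormZ; apply: le_trans (ler_wpM2r (rnorm_ge0 v) zw) _.
by rewrite mulrAC ler_pdivrMr// ler_wpM2l ?lerDl// ltW.
Qed.

End nets.

Section truncation.
Context {R : realType} {X : topologicalType}.
Implicit Types f : C0 R X.

Lemma C0_trunc_subproof (d : R) f : 0 < d ->
  (fun x => (d / Num.max d (rnorm (f x)))%:C * f x) \in is_C0.
Proof.
move=> d0; have m0 x : 0 < Num.max d (rnorm (f x)) by rewrite lt_max d0.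
apply: (C0_dominated (M := 1) (valP f)) => x.
  apply: cvgM; last exact: C0_continuous.
  apply: (@continuous_comp _ _ _ (fun x => d / Num.max d (rnorm (f x)))); last first.
    exact: real_complex_continuous.
  apply: cvgM; first exact: cvg_cst.
  apply: cvgV; first by rewrite gt_eqF.
  apply: (@continuous_max _ _ (cst d) (fun x => rnorm (f x))); first exact: cvg_cst.
  by apply: continuous_comp; [exact: C0_continuous|exact: rnorm_continuous].
rewrite rnormM rnorm_real ler_wpM2r ?rnorm_ge0//.
rewrite ger0_norm; last by rewrite divr_ge0// ltW.
by rewrite ler_pdivrMr// mul1r le_max lexx.
Qed.

(** Radial truncation at height [d], written so that no division by 0 occurs at
    the zeros of [f]. *)
Definition C0_trunc (d : R) (d0 : 0 < d) f : C0 R X := MkC0 _ (C0_trunc_subproof f d0).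

Lemma C0_truncE d (d0 : 0 < d) f x : rnorm (f x) <= d -> C0_trunc d0 f x = f x.
Proof. by move=> fd /=; rewrite (max_idPl fd) divff ?gt_eqF// mul1r. Qed.

Lemma C0_trunc_le d (d0 : 0 < d) f : rnorm (C0_trunc d0 f) <= d.
Proof.
apply: C0_norm_le => [|x]; first exact: ltW.
have m0 : 0 < Num.max d (rnorm (f x)) by rewrite lt_max d0.
rewrite /= rnormM rnorm_real ger0_norm; last by rewrite divr_ge0// ltW.
by rewrite mulrAC ler_pdivrMr// ler_wpM2l ?(ltW d0)// le_max lexx orbT.
Qed.

Lemma C0_trunc_dist_le d (d0 : 0 < d) f : rnorm (f - C0_trunc d0 f) <= rnorm f.
Proof.
apply: C0_norm_le => [|x]; first exact: rnorm_ge0.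
have m0 : 0 < Num.max d (rnorm (f x)) by rewrite lt_max d0.
rewrite C0B /= -[X in X - _]mul1r -mulrBl rnormM.
apply: le_trans (C0_le f x); rewrite -[leRHS]mul1r ler_wpM2r ?rnorm_ge0//.
rewrite -rmorphB rnorm_real ger0_norm; first by rewrite gerBl divr_ge0// ltW.
by rewrite subr_ge0 ler_pdivrMr// mul1r le_max lexx.
Qed.

End truncation.

Section monomials.
Context {R : realType} {X : topologicalType} {H : hilbert R}.
Variables (phi : homeo X) (rho : faithful_rep X H).
Implicit Types (T : bop (l2 H)) (f g : C0 R X).
Local Notation U := (Uf phi rho).
Local Notation al n := (iter n (alpha phi)).
Local Notation unit_ball := [set T | semicrossed phi rho T /\ rnorm T <= 1].

(** At degree [m + n + l] the coefficient is
    [(f o phi^(n+l)) (c_l o phi^n) g]; this is where the functions [u_l] enter. *)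
Lemma has_coefs_monomials m n f g T c : has_coefs phi rho T c ->
  has_coefs phi rho (mult_op (U m f) (U n g) T) (fun p => if (m + n <= p)%N then
     C0_mul (al (p - m) f) (C0_mul (al n (c (p - m - n)%N)) g) else 0).
Proof.
move=> Tc; rewrite mult_opE.
have TU := has_coefs_comp Tc (has_coefs_Uf phi rho n g).
have := has_coefs_comp (has_coefs_Uf phi rho m f) TU.
congr has_coefs; apply/funext => p; apply: C0_ext => x; rewrite C0_sum.
have inner q : (\sum_(k < q.+1) C0_mul (al k (c (q - k)%N)) (if k == n :> nat then g else 0)) x
    = if (n <= q)%N then al n (c (q - n)%N) x * g x else 0.
  rewrite C0_sum; case: leqP => nq.
    rewrite (bigD1 (Ordinal (nq : (n < q.+1)%N)))// big1 => [|k kn].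
      by rewrite /= addr0 eqxx.
    rewrite C0M ifF ?mulr0//; apply/negbTE.
    by apply: contra kn => /eqP kn; apply/eqP/val_inj.
  rewrite big1// => k _; rewrite C0M ifF ?mulr0//; apply/negbTE/eqP.
  by have := ltn_ord k; lia.
have [pm|mp] := ltnP p m.
  rewrite ifF; last by apply/negbTE; lia.
  rewrite big1// => k _; rewrite C0M ifF ?iter_alpha0 ?mul0r//.
  by apply/negbTE/eqP; lia.
have kp : (p - m < p.+1)%N by lia.
rewrite (bigD1 (Ordinal kp))// [\big[_/_]_(i | i != Ordinal kp) _]big1 => [|k kn]; last first.
  rewrite C0M ifF ?iter_alpha0 ?mul0r//; apply/negbTE/eqP => kE; move/negP: kn; apply.
  by apply/eqP/val_inj => /=; have := ltn_ord k; lia.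
rewrite [LHS]addr0 C0M inner [val _]/= subKn// eqxx leq_subRL//.
by case: ifP => _; rewrite ?mulr0// !C0M.
Qed.

(** The coefficients only see the values of [f] on the forward orbits of the
    points of the support of [g]. *)
Lemma mult_op_congr m n f f' g T : semicrossed phi rho T ->
  (forall l x, g x != 0 -> f (iter (n + l) phi x) = f' (iter (n + l) phi x)) ->
  mult_op (U m f) (U n g) T = mult_op (U m f') (U n g) T.
Proof.
move=> hT ff'; have hc := has_coefs_monomials m n _ g (has_coefs_fourier hT).
apply: (has_coefs_ext (hc f)); have := hc f'; congr has_coefs.
apply/funext => p; case: ifP => // mnp; apply: C0_ext => x; rewrite !C0M !iter_alphaE.
have [->|gx] := eqVneq (g x) 0; first by rewrite !mulr0.
have -> : (p - m = n + (p - m - n))%N by lia.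
by rewrite ff'.
Qed.

(** The bound on the products does not bound [f] and [g] separately, but it does
    after cutting [g] at height [c].  The part of [g] below [c] has a small norm.  On
    the support of the rest, [|g| > c], so [|f| <= c] along the forward orbits when all
    products are at most [c^2], and [f] may be replaced by its truncation at [c]. *)
Lemma mult_op_small m n (M e : R) : 0 <= M -> 0 < e -> exists2 d : R, 0 < d &
  forall f g T, rnorm f <= M -> rnorm g <= M ->
    (forall l x, rnorm (f (iter (n + l) phi x) * g x) <= d) ->
    unit_ball T -> rnorm (mult_op (U m f) (U n g) T) <= e.
Proof.
move=> M0 e0; pose c := e / (2 * (M + 1)).
have c0 : 0 < c by rewrite divr_gt0// mulr_gt0// ltr_wpDl.
have Mc : M * c <= e / 2 by exact: half_eps.
exists (c * c) => [|f g T fM gM fg [hT T1]]; first exact: mulr_gt0.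
pose g2 := C0_trunc c0 g; pose g1 := g - g2; pose f' := C0_trunc c0 f.
have -> : mult_op (U m f) (U n g) T = mult_op (U m f) (U n g1) T + mult_op (U m f) (U n g2) T.
  by rewrite -mult_opDr -linearD subrK.
have bound f0 g0 : rnorm (mult_op (U m f0) (U n g0) T) <= rnorm f0 * rnorm g0.
  apply: le_trans (mult_op_le _ _ _) _; apply: ler_pM (Uf_le _ _ _ _).
  - by rewrite mulr_ge0 ?rnorm_ge0.
  - exact: rnorm_ge0.
  - rewrite -[leRHS]mulr1; apply: ler_pM (Uf_le _ _ _ _) T1; exact: rnorm_ge0.
apply: le_trans (rnormD _ _) _; rewrite (splitr e); apply: lerD.
  rewrite (mult_op_congr m (f' := f') hT) => [|l x gx].
    apply: le_trans (bound _ _) _; apply: le_trans Mc; rewrite mulrC.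
    apply: ler_pM; do ?exact: rnorm_ge0; last exact: C0_trunc_le.
    exact: le_trans (C0_trunc_dist_le _ _) gM.
  rewrite C0_truncE// leNgt; apply/negP => cf.
  have cg : c < rnorm (g x).
    rewrite ltNge; apply/negP => gc; move/negP: gx; apply.
    by rewrite C0B C0_truncE// subrr.
  have := fg l x; rewrite leNgt => /negP; apply; rewrite rnormM.
  by apply: ltr_pM => //; exact: ltW.
apply: le_trans (bound _ _) _; apply: le_trans Mc.
by apply: ler_pM fM (C0_trunc_le _ _); exact: rnorm_ge0.
Qed.

End monomials.

(** * The conditions imply compactness *)

(** For an infinite [S], the complements of the sets having finite intersection
    with [S] form a proper filter containing [K]; no cluster point is possible. *)
Lemma compact_locally_subsingleton_finite (X : topologicalType) (K S : set X) :
  compact K -> S `<=` K ->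
  (forall x, exists2 V, nbhs x V & forall z, V z -> S z -> z = x) -> finite_set S.
Proof.
move=> cK SK SV; apply: contrapT => Sinf.
pose F : set_system X := [set W | finite_set (S `\` W)].
have FF : ProperFilter F.
  split; first by rewrite /F/= setD0.
  split=> [|W W' WF WF'|W W' WW' WF]; rewrite /F/=.
  - by rewrite setDT; exact: finite_set0.
  - by rewrite setDIr finite_setU.
  - apply: sub_finite_set WF => z [Sz nW']; split => // Wz.
    by apply: nW'; exact: WW'.
have FK : F K.
  by rewrite /F/= (_ : S `\` K = set0)// setD_eq0.
have [x [_ clx]] := cK F FF FK.
have [V xV VS] := SV x.
have FSx : F (S `\ x).
  apply: (@sub_finite_set _ _ [set x]); last exact: finite_set1.
  by move=> z [Sz nz]; apply: contrapT => zx; apply: nz.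
by have [z [[Sz zx] Vz]] := clx _ _ FSx xV; apply: zx; exact: VS.
Qed.

Section isolated_points.
Context {R : realType} {X : topologicalType}.
Hypothesis Xm : metrizable R X.
Implicit Types (x y z : X) (f : C0 R X) (s : seq X).

Lemma isolated_nbhs x : isolated [set: X] x <-> nbhs x [set x].
Proof.
split=> [[_ [V xV]]|xx]; first by rewrite setIT => <-.
by split; [rewrite inE|exists [set x]; rewrite ?setIT].
Qed.

Lemma isolated_homeo (phi : homeo X) x :
  isolated [set: X] x -> isolated [set: X] (phi x).
Proof.
move=> /isolated_nbhs xx; apply/isolated_nbhs.
have xx' : nbhs (homeo_inv phi (phi x)) [set x] by rewrite homeo_funK.
have := @homeo_inv_continuous _ phi (phi x) _ xx'.
apply: (@filterS _ (nbhs (phi x)) _ (homeo_inv phi @^-1` [set x])) => z /= <-.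
by rewrite homeo_invK.
Qed.

Lemma isolated_iter (phi : homeo X) n x :
  isolated [set: X] x -> isolated [set: X] (iter n phi x).
Proof. by move=> xi; elim: n => // n ih; exact: isolated_homeo. Qed.

(** The indicator function of [x], which belongs to [C_0(X)] when [x] is isolated;
    the other branch makes the definition total. *)
Definition point_mass x : C0 R X :=
  if pselect ((fun z => (z == x)%:R) \in @is_C0 R X) is left h then MkC0 _ h else 0.

Lemma point_massE x z : isolated [set: X] x -> point_mass x z = (z == x)%:R.
Proof.
move=> /isolated_nbhs xi; rewrite /point_mass; case: pselect => // -[].
apply/asboolP; split=> [u|e e0].
  apply/rnorm_cvgP => e e0; have [->|/eqP ux] := eqVneq u x.
    by apply: filterS xi => v -> /=; rewrite eqxx subrr rnorm0 ltW.
  apply: filterS (metrizable_near_neq Xm ux) => v /eqP/negbTE vx /=.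
  by rewrite vx subrr rnorm0 ltW.
exists [set x]; first exact: compact_set1.
by move=> u /eqP/negbTE ux /=; rewrite ux rnorm0.
Qed.

Definition C0_restr s f : C0 R X := \sum_(y <- s) f y *: point_mass y.

Lemma C0_restrE s f z : uniq s -> (forall y, y \in s -> isolated [set: X] y) ->
  C0_restr s f z = if z \in s then f z else 0.
Proof.
move=> us si; rewrite C0_sum; case: ifP => zs.
  rewrite (bigD1_seq z)// big1_seq => [|y /andP[yz ys]].
    by rewrite [LHS]addr0 C0Z point_massE ?eqxx ?mulr1//; exact: si.
  by rewrite C0Z point_massE ?(negbTE yz) 1?eq_sym ?(negbTE yz) ?mulr0//; exact: si.
rewrite big1_seq// => y /andP[_ ys]; rewrite C0Z point_massE; last exact: si.
by case: eqP => [zy|_]; [rewrite zy ys in zs|rewrite mulr0].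
Qed.

Lemma C0_restr_le s f : uniq s -> (forall y, y \in s -> isolated [set: X] y) ->
  rnorm (C0_restr s f) <= rnorm f.
Proof.
move=> us si; apply: C0_norm_le => [|z]; first exact: rnorm_ge0.
rewrite C0_restrE//; case: ifP => _; first exact: C0_le.
by rewrite rnorm0 rnorm_ge0.
Qed.

Lemma C0_restrC_le s f : uniq s -> (forall y, y \in s -> isolated [set: X] y) ->
  rnorm (f - C0_restr s f) <= rnorm f.
Proof.
move=> us si; apply: C0_norm_le => [|z]; first exact: rnorm_ge0.
rewrite C0B C0_restrE//; case: ifP => _; last by rewrite subr0; exact: C0_le.
by rewrite subrr rnorm0 rnorm_ge0.
Qed.

End isolated_points.

Section sufficiency.
Context {R : realType} {X : topologicalType} {H : hilbert R}.
Hypothesis Xm : metrizable R X.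
Variables (phi : homeo X) (rho : faithful_rep X H).
Implicit Types (T : bop (l2 H)) (f g : C0 R X).
Local Notation U := (Uf phi rho).
Local Notation al n := (iter n (alpha phi)).
Local Notation unit_ball := [set T | semicrossed phi rho T /\ rnorm T <= 1].

Lemma precompact_on_ext (F G : bop (l2 H) -> bop (l2 H)) :
  (forall T, semicrossed phi rho T -> F T = G T) ->
  precompact_on unit_ball G -> precompact_on unit_ball F.
Proof.
move=> FG hG e e0; have [s sP] := hG e e0; exists s => _ [T TB <-].
by rewrite (FG _ (proj1 TB)); exact: sP (imageP _ TB).
Qed.

(** Only the degree [m + n + l] with [phi^(n+l) x = y] contributes, and there the
    coefficient is a scalar multiple of the point mass at [x]. *)
Lemma point_mass_precompact m n x y :
  isolated [set: X] x -> isolated [set: X] y ->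
  (forall l l', iter (n + l) phi x = y -> iter (n + l') phi x = y -> l = l') ->
  precompact_on unit_ball (mult_op (U m (point_mass y)) (U n (point_mass x))).
Proof.
move=> xi yi l1.
have coefE T p z : semicrossed phi rho T -> (m + n <= p)%N ->
    C0_mul (al (p - m) (point_mass y))
      (C0_mul (al n (fourier phi rho (p - m - n) T)) (point_mass x)) z =
    if (iter (n + (p - m - n)) phi x == y) && (z == x)
    then fourier phi rho (p - m - n) T (iter n phi x) else 0.
  move=> hT mnp; rewrite !C0M !iter_alphaE !point_massE//.
  have -> : (p - m = n + (p - m - n))%N by lia.
  have -> : (n + (p - m - n) - n = p - m - n)%N by lia.
  have [->|_] := eqVneq z x; last by rewrite andbF !mulr0.
  by rewrite andbT; case: eqP => _; rewrite ?mul0r// mul1r mulr1.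
have [[l0 l0y]|nol] := pselect (exists l, iter (n + l) phi x = y); last first.
  apply: precompact_on_ext (precompact_on_cst unit_ball 0) => T hT.
  apply: (has_coefs_ext (has_coefs_monomials m n _ _ (has_coefs_fourier hT))).
  move: (has_coefs0 phi rho); congr has_coefs; apply/funext => p; case: ifP => // mnp.
  apply: C0_ext => z; rewrite coefE//; case: ifP => // /andP[/eqP h _].
  by case: nol; exists (p - m - n)%N.
apply: (precompact_on_ext
  (G := fun T => fourier phi rho l0 T (iter n phi x) *: U (m + n + l0) (point_mass x))).
  move=> T hT; apply: (has_coefs_ext (has_coefs_monomials m n _ _ (has_coefs_fourier hT))).
  rewrite -linearZ; move: (has_coefs_Uf phi rho (m + n + l0)
    (fourier phi rho l0 T (iter n phi x) *: point_mass x)).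
  congr has_coefs; apply/funext => p; case: eqP => [->|pE].
    rewrite ifT ?leq_addr//; apply: C0_ext => z; rewrite coefE ?leq_addr//.
    have -> : (m + n + l0 - m - n = l0)%N by lia.
    rewrite l0y eqxx andTb C0Z point_massE//.
    by case: eqP => _; rewrite ?mulr1 ?mulr0.
  case: ifP => // mnp; apply: C0_ext => z; rewrite coefE//.
  case: ifP => // /andP[/eqP h _]; have := l1 _ _ h l0y; lia.
apply: precompact_on_line => T [hT T1]; apply: le_trans (C0_le _ _) _.
exact: le_trans (fourier_le _ hT) T1.
Qed.

(** Approximation of [f] and [g] by finite combinations of point masses, at the
    points where some [u_l] is not small and at their finitely many relevant images. *)
Lemma monomials_precompact m n f g :
  (forall l x, limit_point [set: X] x -> f (iter (n + l) phi x) * g x = 0) ->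
  (forall x, isolated [set: X] x ->
     (fun l => f (iter (n + l) phi x) * g x) @ \oo --> (0 : R[i])) ->
  equicontinuous [set: nat] (fun l x => f (iter (n + l) phi x) * g x) ->
  precompact_on unit_ball (mult_op (U m f) (U n g)).
Proof.
move=> f0 fcvg feq; apply: precompact_on_lim => e e0.
have e20 : 0 < e / 2 by rewrite divr_gt0.
pose M := rnorm f + rnorm g.
have fM : rnorm f <= M by apply: ler_wpDr (rnorm_ge0 g) (lexx _).
have gM : rnorm g <= M by apply: ler_wpDl (rnorm_ge0 f) (lexx _).
have M0 : 0 <= M := le_trans (rnorm_ge0 f) fM.
have [d d0 dP] := mult_op_small phi rho m n M0 e20.
pose u l x := f (iter (n + l) phi x) * g x.
(* The points where some [u_l] exceeds the threshold: isolated by (a) and (c), and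
   contained in a compact set because [g] vanishes at infinity. *)
pose S := [set x | exists l, d <= rnorm (u l x)].
have near_lim x : limit_point [set: X] x -> \forall z \near x, ~ S z.
  move=> xl; have dC : 0 < d%:C by rewrite ltcR.
  have := feq x _ (entourage_ball R[i] (PosNum dC)).
  apply: filterS => z zP [l]; rewrite leNgt => /negP; apply.
  have := zP l I; rewrite /= f0// -ball_normE/= sub0r normrN -rnormE ltcR.
  by [].
have Siso x : S x -> isolated [set: X] x.
  move=> Sx; have : closure [set: X] x by apply: subset_closure.
  rewrite closure_isolated_limit_point => -[//|/near_lim/nbhs_singleton].
  by move/(_ Sx).
have Sfin : finite_set S.
  have /asboolP[_ /(_ (d / (rnorm f + 1)))[|K cK Kg]] := valP g.
    by rewrite divr_gt0// ltr_wpDl ?rnorm_ge0.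
  apply: (@compact_locally_subsingleton_finite _ K) => // [x [l dl]|x].
    apply: contrapT => /Kg; rewrite ltr_pdivlMr ?ltr_wpDl ?rnorm_ge0// => gx.
    move: dl; rewrite leNgt => /negP; apply; apply: le_lt_trans gx.
    rewrite rnormM mulrC ler_wpM2l ?rnorm_ge0//; apply: le_trans (C0_le _ _) _.
    by rewrite lerDl.
  have : closure [set: X] x by apply: subset_closure.
  rewrite closure_isolated_limit_point => -[/isolated_nbhs xx|xl].
    by exists [set x] => // z ->.
  by exists (~` S); first exact: near_lim.
have [s0 s0S] := (finite_seqP _).1 Sfin.
pose s := undup s0.
have us : uniq s by exact: undup_uniq.
have sS x : (x \in s) = `[< S x >].
  by rewrite mem_undup s0S; apply/idP/asboolP.
have si x : x \in s -> isolated [set: X] x by rewrite sS => /asboolP/Siso.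
(* By (b), only the images [phi^(n+l) x] with [x] in [s] and [l < L] matter for [f]. *)
have [L LP] : exists L, forall x, x \in s -> forall l, (L <= l)%N -> rnorm (u l x) <= d.
  elim: (s) si => [|x r ih] ri; first by exists 0%N.
  have [|L LP] := ih; first by move=> z zr; apply: ri; rewrite inE zr orbT.
  have /rnorm_cvgP/(_ _ d0)[N _ NP] := fcvg _ (ri _ (mem_head _ _)).
  exists (maxn L N) => z; rewrite inE => /orP[/eqP->|zr] l; rewrite geq_max => /andP[Ll Nl].
    by have := NP l Nl; rewrite /= subr0.
  exact: LP.
pose t := undup [seq iter (n + l) phi x | x <- s, l <- iota 0 L].
have ut : uniq t by exact: undup_uniq.
have ti y : y \in t -> isolated [set: X] y.
  rewrite mem_undup => /allpairsP[[x l]/= [xs _ ->]].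
  by apply: isolated_iter; exact: si.
pose fF := C0_restr t f; pose gS := C0_restr s g.
exists (mult_op (U m fF) (U n gS)); last first.
  move=> T TB.
  rewrite mult_opB -!linearB.
  rewrite (splitr e); apply: le_trans (rnormD _ _) _; apply: lerD; apply: dP => //.
  - exact: le_trans (C0_restrC_le Xm _ us si) gM.
  - move=> l x; rewrite C0B C0_restrE//; case: ifP => [_|xs].
      by rewrite subrr mulr0 rnorm0 ltW.
    rewrite subr0 leNgt; apply/negP => dl; move/negP: xs; apply.
    by rewrite sS; apply/asboolP; exists l; exact: ltW.
  - exact: le_trans (C0_restrC_le Xm _ ut ti) fM.
  - exact: le_trans (C0_restr_le Xm _ us si) gM.
  - move=> l x; rewrite [gS x]C0_restrE//; case: ifP => xs; last by rewrite mulr0 rnorm0 ltW.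
    rewrite C0B C0_restrE//; case: ifP => xt; first by rewrite subrr mul0r rnorm0 ltW.
    rewrite subr0; apply: LP => //; rewrite leqNgt; apply/negP => lL.
    move/negP: xt; apply; rewrite mem_undup; apply/allpairsP.
    by exists (x, l); rewrite mem_iota add0n.
apply: (@precompact_on_ext _ (fun T => \sum_(y <- t) \sum_(x <- s)
  (f y * g x) *: mult_op (U m (point_mass y)) (U n (point_mass x)) T)).
  move=> T _; rewrite /fF /gS /C0_restr !linear_sum mult_op_sum.
  apply: eq_bigr => y _; apply: eq_bigr => x _.
  by rewrite !linearZ mult_opZ.
apply: precompact_on_sum => y yt; apply: precompact_on_sum => x xs.
(* If the orbit of [x] visits [y] twice, it does so periodically, and (b) makes the
   value [f y * g x], repeated infinitely often, equal to 0. *)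
have [[l [p [p0 ly py]]]|once] := pselect (exists l p, [/\ (0 < p)%N,
    iter (n + l) phi x = y & iter p phi y = y]).
  have fg0 : f y * g x = 0.
    apply: rnorm_dist_small_eq => r r0; rewrite subr0.
    have /rnorm_cvgP/(_ _ r0)[N _ NP] := fcvg _ (si _ xs).
    have Nle : (N <= N * p + l)%N by rewrite (leq_trans (leq_pmulr N p0))// leq_addr.
    have := NP _ Nle; rewrite /= subr0 addnCA iterD ly.
    have -> : iter (N * p) phi y = y by elim: (N) => // k ih; rewrite mulSn iterD ih.
    by [].
  by apply: precompact_on_ext (precompact_on_cst _ 0) => T _; rewrite fg0 scale0r.
apply: precompact_onZ; apply: point_mass_precompact; [exact: si|exact: ti|].
suff lt_once l l' : (l < l')%N -> iter (n + l) phi x = y -> iter (n + l') phi x = y -> False.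
  move=> l l' ly l'y; case: (ltngtP l l') => // ll'.
    by case: (lt_once _ _ ll' ly l'y).
  by case: (lt_once _ _ ll' l'y ly).
move=> ll' ly l'y; apply: once; exists l, (l' - l)%N; split => //.
  by rewrite subn_gt0.
by rewrite -{1}ly -iterD addnCA subnK// ltnW.
Qed.

(** Fejer means of [A] and [B] are finite combinations of the monomials built on
    their Fourier coefficients. *)
Lemma mult_op_precompact A B : semicrossed phi rho A -> semicrossed phi rho B ->
  (forall m n, precompact_on unit_ball
     (mult_op (U m (fourier phi rho m A)) (U n (fourier phi rho n B)))) ->
  precompact_on unit_ball (mult_op A B).
Proof.
move=> hA hB AB; apply: precompact_on_lim => e e0.
have pos (z : R) : 0 <= z -> 0 < e / (2 * (z + 1)).
  by move=> z0; rewrite divr_gt0// mulr_gt0// ltr_wpDl.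
have [N BN] := fejer_approx hB (pos _ (rnorm_ge0 A)).
set B' := fejer _ _ _ _ in BN.
have [M AM] := fejer_approx hA (pos _ (rnorm_ge0 B')).
set A' := fejer _ _ _ _ in AM.
exists (mult_op A' B') => [|T [hT T1]].
  apply: (@precompact_on_ext _ (fun T => \sum_(m < M) \sum_(n < N)
    (fejer_weight M m * fejer_weight N n) *:
      mult_op (U m (fourier phi rho m A)) (U n (fourier phi rho n B)) T)).
    move=> T _; rewrite /A' /B' /fejer mult_op_sum.
    by apply: eq_bigr => m _; apply: eq_bigr => n _; rewrite !linearZ mult_opZ.
  apply: precompact_on_sum => m _; apply: precompact_on_sum => n _.
  exact: precompact_onZ.
have step C D (r : R) : rnorm C * rnorm D <= r -> rnorm (mult_op C D T) <= r.
  move=> /(le_trans _); apply; apply: le_trans (mult_op_le _ _ _) _.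
  apply: ler_wpM2r; first exact: rnorm_ge0.
  by rewrite -[leRHS]mulr1; apply: ler_wpM2l T1; exact: rnorm_ge0.
rewrite mult_opB (splitr e); apply: le_trans (rnormD _ _) _; apply: lerD; apply: step.
  rewrite [X in _ * X]rnorm_distC; apply: le_trans (ler_wpM2l (rnorm_ge0 _) BN) _.
  by apply: half_eps => //; exact: rnorm_ge0.
rewrite [X in X * _]rnorm_distC mulrC; apply: le_trans (ler_wpM2l (rnorm_ge0 _) AM) _.
by apply: half_eps => //; exact: rnorm_ge0.
Qed.

(** The closure of the image of the ball is compact since the operator space is
    complete, and stays in the semicrossed product, which is a closed algebra. *)
Lemma precompact_compact_operator A B : semicrossed phi rho A -> semicrossed phi rho B ->
  precompact_on unit_ball (mult_op A B) ->
  compact_operator_on (semicrossed phi rho) (mult_op A B).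
Proof.
move=> hA hB AB; exists (closure (mult_op A B @` unit_ball)).
  split; first by apply: net_compact_closure AB; exact: Uf_bop_complete.
  move=> T /closure_rnormP hT; apply: semicrossed_closed => e /hT[_ [S [hS _] <-] ST].
  exists (mult_op A B S) => //; apply: semicrossed_comp => //.
  exact: semicrossed_comp.
move=> T hT T1; apply: subset_closure; exists T => //; split => //.
by rewrite rnorm_le.
Qed.

End sufficiency.

(** * The characterization *)

Theorem theorem2p6 (R : realType) (X : topologicalType)
  (Xlc : locally_compact [set: X]) (Xm : metrizable R X) (phi : homeo X)
  (H : hilbert R) (rho : faithful_rep X H) (A B : bop (l2 H))
  (hA : semicrossed phi rho A) (hB : semicrossed phi rho B) :
  let f (m : nat) : C0 R X := fourier phi rho m A in
  let g (m : nat) : C0 R X := fourier phi rho m B in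
  compact_operator_on (semicrossed phi rho) (mult_op A B) <->
  (forall m n : nat,
    [/\ forall (l : nat) (x : X), limit_point [set: X] x ->
          f m (iter (n + l) phi x) * g n x = 0,
        forall x : X, isolated [set: X] x ->
          (fun l : nat => f m (iter (n + l) phi x) * g n x) @ \oo --> (0 : R[i])
      & equicontinuous [set: nat]
          (fun (l : nat) (x : X) => f m (iter (n + l) phi x) * g n x)]).
Proof.
move=> f g; split=> [cM m n|fg]; first exact: compact_mult_conditions.
apply: precompact_compact_operator => //; apply: mult_op_precompact => // m n.
by have [] := fg m n; exact: monomials_precompact.
Qed.
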